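(* Let $(W,S)$ be a Coxeter system of finite rank and let $\ast$ be an involutive automorphism of $W$ preserving $S$. Let $\mathcal{C}\subseteq \mathbf{I}_{W,\ast}$ be closed under $\ast$-twisted conjugation and let $\mathcal{C}_I=\mathcal{C}\cap W_I$ for $I\subseteq S$. Then the power series $\mathcal{C}(q)$ is rational. Moreover, if $W$ is infinite, then $$\sum_{I\subseteq S,\ I=I^{\ast}}(-1)^{r_{\ast}(I)}\frac{\mathcal{C}_I(q)}{W_I(q^2)}=0,$$ or, equivalently, $$\frac{\mathcal{C}(q)}{W(q^2)}=\sum_{I\subsetneq S,\ I=I^{\ast}}(-1)^{r_{\ast}(S\setminus I)-1}\frac{\mathcal{C}_I(q)}{W_I(q^2)}.$$ If $W$ is finite, let $w_0$ be the longest element of $W$ and $N=\ell(w_0)$. Then $$\frac{\mathcal{C}(q)+(-1)^{r_{\ast}(S)-1}q^{2N}\mathcal{C}(-q^{-1})}{W(q^2)}=\sum_{I\subsetneq S,\ I=I^{\ast}}(-1)^{r_{\ast}(S\setminus I)-1}\frac{\mathcal{C}_I(q)}{W_I(q^2)}.$$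
   Context: $(W,S)$ is a Coxeter system with $S$ finite, with length function $\ell$. The automorphism $\ast:W\to W$, $w\mapsto w^\ast$, satisfies $\ast^2=\mathrm{id}$ (the case $\ast=\mathrm{id}$ is allowed) and $S^\ast=S$. The set of $\ast$-twisted involutions is $\mathbf{I}_{W,\ast}=\{z\in W: z^{\ast}=z^{-1}\}$. A subset $\mathcal{C}\subseteq\mathbf{I}_{W,\ast}$ is closed under $\ast$-twisted conjugation if $x^{-1}zx^{\ast}\in\mathcal{C}$ for all $z\in\mathcal{C}$, $x\in W$. For $A\subseteq W$, $A(q)=\sum_{w\in A}q^{\ell(w)}$ (a formal power series; rational means it is the expansion of a quotient of polynomials). For $I\subseteq S$, $W_I=\langle I\rangle$ is the parabolic subgroup generated by $I$, and $W_I(q)=\sum_{w\in W_I}q^{\ell(w)}$. For a $\ast$-stable subset $J\subseteq S$ (i.e. $J=J^\ast$), $r_{\ast}(J)=|J/\langle\ast\rangle|$ is the number of orbits of $\ast$ acting on $J$. *)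

(* Defs.v *)
From HB Require Import structures.
From mathcomp Require Import all_boot all_order all_algebra.
From mathcomp Require Import finmap mathcomp_extra boolp classical_sets.
From mathcomp Require Import functions cardinality fsbigop.

Set Implicit Arguments.
Unset Strict Implicit.
Unset Printing Implicit Defensive.

Import GRing.Theory.
Local Open Scope ring_scope.

Record fps (R : Type) := Fps { fps_coef :> nat -> R }.

Lemma fpsP (R : Type) (f g : fps R) : (forall n, f n = g n) -> f = g.
Proof. by case: f g => [f] [g] /= /funext ->. Qed.

HB.instance Definition _ (R : Type) := gen_eqMixin (fps R).
HB.instance Definition _ (R : Type) := gen_choiceMixin (fps R).

Section FpsZmod.
Variable V : zmodType.

Definition fps_zero : fps V := Fps (fun=> 0).
Definition fps_opp (f : fps V) : fps V := Fps (fun n => - f n).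
Definition fps_add (f g : fps V) : fps V := Fps (fun n => f n + g n).

Fact fps_addA : associative fps_add.
Proof. by move=> f g h; apply: fpsP => n /=; rewrite addrA. Qed.
Fact fps_addC : commutative fps_add.
Proof. by move=> f g; apply: fpsP => n /=; rewrite addrC. Qed.
Fact fps_add0 : left_id fps_zero fps_add.
Proof. by move=> f; apply: fpsP => n /=; rewrite add0r. Qed.
Fact fps_addN : left_inverse fps_zero fps_opp fps_add.
Proof. by move=> f; apply: fpsP => n /=; rewrite addNr. Qed.

HB.instance Definition _ :=
  GRing.isZmodule.Build (fps V) fps_addA fps_addC fps_add0 fps_addN.

Lemma fps_coef0 n : (0 : fps V) n = 0. Proof. by []. Qed.
Lemma fps_coefD (f g : fps V) n : (f + g) n = f n + g n. Proof. by []. Qed.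
Lemma fps_coefN (f : fps V) n : (- f) n = - f n. Proof. by []. Qed.

Lemma fps_coef_sum (I : Type) (r : seq I) (P : pred I) (F : I -> fps V) n :
  (\sum_(i <- r | P i) F i) n = \sum_(i <- r | P i) F i n.
Proof. by elim/big_rec2: _ => // i x y _ <-. Qed.
End FpsZmod.

Section FpsRing.
Variable R : comNzRingType.
Implicit Types (f g h : fps R) (p : {poly R}).

Definition fps_of_poly p : fps R := Fps (fun n => p`_n).

Definition fps_one : fps R := Fps (fun n => (n == 0%N)%:R).
Definition fps_mul f g : fps R :=
  Fps (fun n => \sum_(i < n.+1) f i * g (n - i)%N).

Let trunc n f : {poly R} := \poly_(i < n.+1) f i.

Let coef_mul_trunc n k f g p1 p2 : (k <= n)%N ->
    (forall i, (i <= n)%N -> p1`_i = f i) ->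
    (forall i, (i <= n)%N -> p2`_i = g i) ->
  (p1 * p2)`_k = fps_mul f g k.
Proof.
move=> kn p1f p2g; rewrite coefM; apply: eq_bigr => i _.
have ik : (i <= k)%N by rewrite -ltnS.
by rewrite p1f ?p2g ?(leq_trans _ kn) ?leq_subr.
Qed.

Let coef_trunc n f i : (i <= n)%N -> (trunc n f)`_i = f i.
Proof. by move=> lein; rewrite coef_poly ltnS lein. Qed.

Fact fps_mulA : associative fps_mul.
Proof.
move=> f g h; apply: fpsP => n.
have gh := @coef_mul_trunc n _ g h _ _ _ (coef_trunc g) (coef_trunc h).
have fg := @coef_mul_trunc n _ f g _ _ _ (coef_trunc f) (coef_trunc g).
rewrite -(coef_mul_trunc (leqnn n) (coef_trunc f) gh).
by rewrite -(coef_mul_trunc (leqnn n) fg (coef_trunc h)) mulrA.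
Qed.

Fact fps_mulC : commutative fps_mul.
Proof.
move=> f g; apply: fpsP => n.
rewrite -(coef_mul_trunc (leqnn n) (coef_trunc f) (coef_trunc g)).
by rewrite -(coef_mul_trunc (leqnn n) (coef_trunc g) (coef_trunc f)) mulrC.
Qed.

Fact fps_mul1 : left_id fps_one fps_mul.
Proof.
move=> f; apply: fpsP => n /=.
by rewrite big_ord_recl mul1r subn0 big1 ?addr0 // => i _; rewrite mul0r.
Qed.

Fact fps_mulDl : left_distributive fps_mul (@fps_add R).
Proof.
move=> f g h; apply: fpsP => n /=.
by rewrite -big_split; apply: eq_bigr => i _; rewrite mulrDl.
Qed.

Fact fps_one_neq0 : fps_one != 0.
Proof.
apply/eqP => /(congr1 (fun f : fps R => f 0%N)) /= /eqP.
by rewrite oner_eq0.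
Qed.

HB.instance Definition _ := GRing.Zmodule_isComNzRing.Build (fps R)
  fps_mulA fps_mulC fps_mul1 fps_mulDl fps_one_neq0.

Lemma fps_coef1 n : (1 : fps R) n = (n == 0%N)%:R. Proof. by []. Qed.
Lemma fps_coefM f g n : (f * g) n = \sum_(i < n.+1) f i * g (n - i)%N.
Proof. by []. Qed.

Definition fps_const (c : R) : fps R := Fps (fun n => c *+ (n == 0%N)).

Lemma fps_coef_const c f n : (fps_const c * f) n = c * f n.
Proof.
rewrite fps_coefM big_ord_recl subn0 big1 ?addr0 // => i _.
by rewrite /= mulr0n mul0r.
Qed.

Lemma fps_coefX_small g k n : g 0%N = 0 -> (n < k)%N -> (g ^+ k) n = 0.
Proof.
move=> g0; elim: k n => // k IHk n; rewrite ltnS => nk.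
rewrite exprS fps_coefM big_ord_recl g0 mul0r add0r big1 // => i _.
rewrite IHk ?mulr0 //; apply: leq_trans nk; rewrite lift0.
by case: n i => [[]//|n i]; rewrite subSS ltnS leq_subr.
Qed.

(* The substitution q := q ^ k in f, for k > 0. *)
Definition fps_subst_exp (k : nat) f : fps R :=
  Fps (fun n => if (k %| n)%N then f (n %/ k)%N else 0).

End FpsRing.

Section FpsUnitRing.
Variable R : comUnitRingType.
Implicit Types f g : fps R.

Definition fps_unit : pred (fps R) := fun f => f 0%N \is a GRing.unit.

(* With a := f 0, this is a^-1 times the geometric series in 1 - a^-1 * f,
   whose n-th coefficient only involves the terms of index k <= n. *)
Definition fps_inv f : fps R :=
  if fps_unit f then
    let g := 1 - fps_const (f 0%N)^-1 * f in
    Fps (fun n => (f 0%N)^-1 * \sum_(k < n.+1) (g ^+ k) n)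
  else f.

Fact fps_mulV : {in fps_unit, left_inverse 1 fps_inv *%R}.
Proof.
move=> f fU; rewrite /fps_inv (_ : fps_unit f = true) //.
set a := f 0%N; set g := 1 - _.
have aU : a \is a GRing.unit by [].
have g0 : g 0%N = 0.
  by rewrite fps_coefD fps_coefN fps_coef_const fps_coef1 mulVr // subrr.
apply: fpsP => n.
pose G := \sum_(k < n.+1) g ^+ k.
have GE i : (i <= n)%N -> \sum_(k < i.+1) (g ^+ k) i = G i.
  move=> lein; rewrite /G fps_coef_sum.
  rewrite (big_ord_widen n.+1 (fun k => (g ^+ k) i)) // big_mkcond /=; apply: eq_bigr => k _.
  by case: ltnP => // ik; rewrite fps_coefX_small.
transitivity ((G * (fps_const a^-1 * f)) n).
  rewrite [LHS]fps_coefM [RHS]fps_coefM; apply: eq_bigr => i _.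
  by rewrite fps_coef_const [Fps _ i]/= GE; [rewrite mulrCA mulrA|rewrite -ltnS].
have -> : fps_const a^-1 * f = 1 - g by rewrite /g opprB addrC subrK.
have -> : G * (1 - g) = 1 - g ^+ n.+1.
  by rewrite -[RHS]opprB subrX1 -mulNr (opprB g 1) mulrC.
by rewrite fps_coefD fps_coefN fps_coefX_small // subr0.
Qed.

Fact fps_unitPl f g : g * f = 1 -> fps_unit f.
Proof.
move/(congr1 (fun h : fps R => h 0%N)).
rewrite fps_coefM big_ord_recl big_ord0 addr0 subnn => gf.
by apply/unitrP; exists (g 0%N); rewrite gf mulrC gf.
Qed.

Fact fps_invr_out : {in [predC fps_unit], fps_inv =1 id}.
Proof. by move=> f /negP fN; rewrite /fps_inv; case: ifP => // /fN. Qed.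

HB.instance Definition _ := GRing.ComNzRing_hasMulInverse.Build (fps R)
  fps_mulV fps_unitPl fps_invr_out.
End FpsUnitRing.

Definition fps_rational (f : fps rat) : Prop :=
  exists P Q : {poly rat}, Q.[0] != 0 /\ f = fps_of_poly P / fps_of_poly Q.

Local Open Scope classical_set_scope.
Local Open Scope group_scope.

Section Coxeter.
Variable W : groupType.
Implicit Types (S I J : {fset W}) (A : set W) (star : W -> W).

Definition is_order (x : W) (n : nat) : Prop :=
  [/\ (0 < n)%N, x ^+ n = 1
    & forall m, (0 < m)%N -> x ^+ m = 1 -> (n <= m)%N].

Definition subgroup A : Prop :=
  [/\ A 1, forall x y, A x -> A y -> A (x * y) & forall x, A x -> A x^-1].

(* The subgroup generated by I; the parabolic subgroup W_I if I is a subset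
   of the set of simple reflections. *)
Definition parabolic I : set W := smallest subgroup [set` I].

(* S is a set of elements of order 2 that generates W, and W is presented by
   the generators S and the relations (s t) ^ m(s, t) = 1, for s, t in S such
   that the order m(s, t) of s t is finite. The presentation is expressed by
   its universal property; only the values of f on S matter. *)
Definition coxeter_system S : Prop :=
  [/\ forall s, s \in S -> is_order s 2,
      parabolic S = [set: W]
    & forall (G : groupType) (f : W -> G),
        (forall s t n, s \in S -> t \in S -> is_order (s * t) n ->
           (f s * f t) ^+ n = 1) ->
        exists h : {multiplicative W -> G}, {in S, h =1 f}].

Definition has_word S (w : W) (n : nat) : Prop :=
  exists s : seq W, [/\ size s = n, {subset s <= S} & w = \prod_(x <- s) x].

(* The default value 0 is only used if w is not a product of elements of S. *)
Definition clength S (w : W) : nat :=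
  xget 0%N [set n | has_word S w n /\ forall m, has_word S w m -> (n <= m)%N].

(* The series A(q); its coefficients are cardinals of finite sets because S is
   finite and generates W. *)
Definition gen_series S A : fps rat :=
  Fps (fun n => #|` fset_set (A `&` [set w | clength S w = n])|%:R%R).

(* The value A(x) at an element x of a ring, for a finite subset A. *)
Definition gen_eval (R : comNzRingType) S A (x : R) : R :=
  (\sum_(w \in A) x ^+ clength S w)%R.

Lemma gen_series_finite S A : finite_set A ->
  gen_series S A = fps_of_poly (gen_eval S A 'X%R).
Proof.
move=> finA; apply: fpsP => n /=.
rewrite /gen_eval fsbig_finite //= coef_sum.
under eq_bigr do rewrite coefXn.
rewrite -natr_sum -big_mkcond big_fset_condE -card_fset_sum1.
congr (#|` _ |%:R)%R; apply/fsetP => w.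
rewrite in_fset_set; last exact: finite_setIl.
rewrite !inE /= in_fset_set //.
apply/idP/andP; rewrite !inE => -[Aw /= wn].
  by rewrite wn.
by split=> //; exact/esym/eqP.
Qed.

Definition twisted_involutions star : set W := [set z | star z = z^-1].

Definition star_stable star J : bool := [fset star s | s in J]%fset == J.

(* The number of orbits {s, star s} of the involution star on J. *)
Definition star_orbits star J : nat :=
  #|` [fset [fset s; star s]%fset | s in J]%fset |.

End Coxeter.

(* The indeterminate q of the field of rational functions Q(q). *)
Definition ratq : {fraction {poly rat}} := tofrac 'X%R.

(* Main.v *)
(* Let z be in C. The map w |-> z w^* permutes the cosets of the parabolic
   subgroups, and it fixes x W_I exactly when I = I^* and x^-1 z x^* is in W_I.
   Hence C_I(q) W(q^2) / W_I(q^2) is the sum over z in C and over the fixed cosets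
   x W_I, with x shortest in its coset, of q^(2 l(x) + l(x^-1 z x^* )), and everything
   reduces to evaluating, for each z, the sum of these monomials with signs
   (-1)^r(I). Write N(w) for the set of reflections (walls) separating 1 and w.
   - The exponent equals l(z) + 2 |N(x) \ N(z)|: twice the number of walls which do
     not separate 1 from z and have the coset on the other side.
   - By length-decreasing twisted conjugations, z = v z0 (v^* )^-1 with
     l(z) = 2 l(v) + l(z0), where s z0 = z0 s^* for each left descent s of z0. Let
     J be the set of these descents; then z0 is the longest element of W_J. If
     cosets are grouped according to their element v x closest to v, then the
     exponent is constant on each group because v lies between 1 and z, and the
     signed sum over a group cancels by adding or removing an orbit {s, s^*} unless
     x^-1 z0 x^* has full support in the *-stable set A of ascents of x.
   - In that case x A x^-1 = J, x^* = x, and z0 x has all right descents. Hence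
     there is no such x if W is infinite, and x = z0 w0 if W is finite. The
     exponent is then 2N - l(z), and the sign is (-1)^r(A) = (-1)^l(z).
   The last sign comes from the twisted form of Solomon's formula for the sign
   character: e(z) = sum over the fixed cosets of (-1)^r(I) satisfies
   sum_z (e(z) - (-1)^l(z))^2 = 0 for finite W, by counting *-stable double cosets.
   Rationality follows by induction on I, since 1 / W_I(q^2) is itself obtained
   from the identity for the trivial star and the class {1}. *)

Require Import Defs.
From HB Require Import structures.
From mathcomp Require Import all_boot all_order all_algebra zify ring lra.
From mathcomp Require Import finmap mathcomp_extra boolp classical_sets.
From mathcomp Require Import functions cardinality fsbigop.

Set Implicit Arguments.
Unset Strict Implicit.
Unset Printing Implicit Defensive.

Import Order.TTheory GRing.Theory Num.Theory.
Local Open Scope fset_scope.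
Local Open Scope group_scope.

(** * The inversion cocycle of a Coxeter group *)

Section SignedReflections.
Variable W : groupType.

Definition conjf (w : W) (A : {fset W}) : {fset W} :=
  [fset t ^ w^-1 | t in A].

Lemma in_conjf w A t : (t \in conjf w A) = (t ^ w \in A).
Proof.
apply/imfsetP/idP => [[u uA ->]|tA]; first by rewrite conjgKV.
by exists (t ^ w); rewrite ?conjgK.
Qed.

Lemma card_conjf w A : #|` conjf w A| = #|` A|.
Proof. by apply: card_imfset; apply: conjg_inj. Qed.

Definition fsymdiff (A B : {fset W}) : {fset W} := (A `\` B) `|` (B `\` A).

Lemma in_fsymdiff A B t : (t \in fsymdiff A B) = (t \in A) (+) (t \in B).
Proof. by rewrite !inE; case: (t \in A); case: (t \in B). Qed.

(* The semidirect product of the sets of elements of W under symmetric difference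
   with W: s |-> ([fset s], s) satisfies the Coxeter relations, because
   the 2n elements (s t)^i s with i < 2n come in equal pairs when (s t)^n = 1. *)
Definition refl_ext := ({fset W} * W)%type.
HB.instance Definition _ := Choice.on refl_ext.

Definition ext_mul (x y : refl_ext) : refl_ext :=
  (fsymdiff x.1 (conjf x.2 y.1), x.2 * y.2).
Definition ext_one : refl_ext := (fset0, 1).
Definition ext_inv (x : refl_ext) : refl_ext := (conjf x.2^-1 x.1, x.2^-1).

Let extP (x y : refl_ext) : x.1 =i y.1 -> x.2 = y.2 -> x = y.
Proof. by case: x y => [A w] [B v] /= /fsetP -> ->. Qed.

Fact ext_mulA : associative ext_mul.
Proof.
move=> x y z; apply: extP => [t|] /=; last exact: mulgA.
by rewrite !(in_fsymdiff, in_conjf) conjgM addbA.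
Qed.
Fact ext_mul1 : left_id ext_one ext_mul.
Proof.
move=> x; apply: extP => [t|] /=; last exact: mul1g.
by rewrite !(in_fsymdiff, in_conjf) conjg1.
Qed.
Fact ext_mulV : left_inverse ext_one ext_inv ext_mul.
Proof.
move=> x; apply: extP => [t|] /=; last exact: mulVg.
by rewrite !(in_fsymdiff, in_conjf) addbb.
Qed.
Fact ext_mulr1 : right_id ext_one ext_mul.
Proof.
move=> x; apply: extP => [t|] /=; last exact: mulg1.
by rewrite !(in_fsymdiff, in_conjf) addbF.
Qed.
Fact ext_mulrV : right_inverse ext_one ext_inv ext_mul.
Proof.
move=> x; apply: extP => [t|] /=; last exact: mulgV.
by rewrite !(in_fsymdiff, in_conjf) conjgK addbb.
Qed.
HB.instance Definition _ := isGroup.Build refl_ext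
  ext_mulA ext_mul1 ext_mulr1 ext_mulV ext_mulrV.

End SignedReflections.

Lemma multiplicative1 (G H : groupType) (h : {multiplicative G -> H}) : h 1 = 1.
Proof. by apply: (mulgI (h 1)); rewrite -gmulfM !mulg1. Qed.

Lemma multiplicativeV (G H : groupType) (h : {multiplicative G -> H}) x :
  h x^-1 = (h x)^-1.
Proof. by apply/esym/mulg1_eq; rewrite -gmulfM mulgV multiplicative1. Qed.

Lemma multiplicativeJ (G H : groupType) (h : {multiplicative G -> H}) x y :
  h (x ^ y) = h x ^ h y.
Proof. by rewrite !conjgE !gmulfM multiplicativeV. Qed.

(** * Parabolic subgroups and induction over their generators *)

Section Parabolic.
Variable W : groupType.
Implicit Types (I J S : {fset W}) (w v s t : W).

Lemma subgroup_parabolic I : subgroup (parabolic I).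
Proof.
split=> [A [[]]//|x y xI yI A hA|x xI A hA].
  by case: (hA) => [[_ AM _] _]; apply: AM; [apply: xI|apply: yI].
by case: (hA) => [[_ _ AV] _]; apply: AV; apply: xI.
Qed.

Lemma parabolic1 I : parabolic I 1.
Proof. by case: (subgroup_parabolic I). Qed.

Lemma parabolicM I w v : parabolic I w -> parabolic I v -> parabolic I (w * v).
Proof. by case: (subgroup_parabolic I) => _ + _; apply. Qed.

Lemma parabolicV I w : parabolic I w^-1 <-> parabolic I w.
Proof.
have [_ _ PV] := subgroup_parabolic I.
by split=> /PV; rewrite ?invgK.
Qed.

Lemma parabolic_gen I s : s \in I -> parabolic I s.
Proof. by move=> sI A [_]; apply. Qed.

Lemma parabolicMl I w v : parabolic I w -> parabolic I (w * v) <-> parabolic I v.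
Proof.
move=> wI; split=> [h|]; last exact: parabolicM.
by rewrite -(mulKg w v); apply: parabolicM => //; apply/parabolicV.
Qed.

Lemma parabolicMr I w v : parabolic I w -> parabolic I (v * w) <-> parabolic I v.
Proof.
move=> wI; split=> [h|h]; last exact: parabolicM.
by rewrite -(mulgK w v); apply: parabolicM => //; apply/parabolicV.
Qed.

Lemma parabolicS I J : I `<=` J -> (parabolic I `<=` parabolic J)%classic.
Proof.
move=> IJ w wI; apply: wI; split; first exact: subgroup_parabolic.
by move=> s /= sI; apply: parabolic_gen; apply: (fsubsetP IJ).
Qed.

(** [Q] itself need not be closed under products. The property that left multiplication by w
    preserves [Q] on W_I is; requiring it of w and of its inverse defines a subgroup containing
    I. *)
Lemma parabolic_ind I (Q : W -> Prop) :
    (forall s, s \in I -> s * s = 1) ->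
    Q 1 -> (forall s w, s \in I -> parabolic I w -> Q w -> Q (s * w)) ->
  forall w, parabolic I w -> Q w.
Proof.
move=> II Q1 QM.
pose A : set W := [set w | parabolic I w /\
                    forall v, parabolic I v -> Q v -> Q (w * v)]%classic.
suff AI : (parabolic I `<=` A)%classic.
  by move=> w wI; rewrite -(mulg1 w); apply: (AI w wI).2 => //; apply: parabolic1.
pose B : set W := [set w | A w /\ A w^-1]%classic.
have BI : B 1 by split; split; rewrite ?invg1 //; try exact: parabolic1; move=> v _;
  rewrite mul1g.
move=> w wI; suff [] : B w by [].
apply: wI; split; last first.
  move=> s sI; have sV : s^-1 = s by rewrite -[LHS]mulg1 -(II _ sI) mulKg.
  have As : A s by split; [exact: parabolic_gen|move=> v; apply: QM].
  by split; rewrite ?sV.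
have AM x y : A x -> A y -> A (x * y).
  move=> [xI xQ] [yI yQ]; split; first exact: parabolicM.
  by move=> v vI Qv; rewrite -mulgA; apply: xQ; [exact: parabolicM|exact: yQ].
split=> //.
  by move=> x y [Ax AVx] [Ay AVy]; split; rewrite ?invgM; apply: AM.
by move=> x [Ax AVx]; split; rewrite ?invgK.
Qed.

End Parabolic.

(* N w is the set of reflections separating 1 and w, so #|` N w| is the length of w.
   S need not generate W: a subset I of S with the same N encodes the Coxeter
   system (W_I, I). *)
Definition inversion_cocycle (W : groupType) (S : {fset W}) (N : W -> {fset W}) : Prop :=
  [/\ forall s, s \in S -> s * s = 1,
      forall s, s \in S -> N s = [fset s]
    & forall w v t, (t \in N (w * v)) = (t \in N w) (+) (t ^ w \in N v)].

Lemma sub_cocycle (W : groupType) (S I : {fset W}) N :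
  inversion_cocycle S N -> I `<=` S -> inversion_cocycle I N.
Proof.
by case=> h1 h2 h3 /fsubsetP IS; split=> // s /IS; [apply: h1|apply: h2].
Qed.

(** The universal property extends s |-> ([fset s], s) to a homomorphism into [refl_ext W]; its
    first component is the cocycle, and its second component is the identity. *)
Lemma coxeter_cocycle (W : groupType) (S : {fset W}) :
  coxeter_system S -> exists N, inversion_cocycle S N.
Proof.
move=> [ord2 gen univ].
have S2 s : s \in S -> s * s = 1 by move=> /ord2[_ + _].
pose f (w : W) : refl_ext W := ([fset w], w).
case: (univ _ f) => [s t n sS tS [n0 stn _]|h hf].
  have sV : s^-1 = s by rewrite -[LHS]mulg1 -(S2 _ sS) mulKg.
  have tV : t^-1 = t by rewrite -[LHS]mulg1 -(S2 _ tS) mulKg.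
  pose p i := (s * t) ^+ i * s.
  have pJ i : p i ^ (s * t)^-1 = p i.+2.
    rewrite conjgE invgK invgM sV tV /p !mulgA -expgS -(mulgA _ s t).
    by rewrite -expgSr.
  (* The first component of a product is a symmetric difference, so membership in it is the parity
     of the number of occurrences among the [p i]. *)
  have stE k x : (x \in ((f s * f t) ^+ k).1) = odd (\sum_(i < 2 * k) (x == p i)).
    elim: k x => [|k IHk] x; first by rewrite muln0 big_ord0.
    rewrite expgS mulnS big_ord_recl big_ord_recl /= in_fsymdiff in_conjf IHk.
    rewrite /= in_fsymdiff in_conjf !oddD !inE !oddb addbA.
    congr (_ (+) _ (+) odd _).
    - by rewrite /p mul1g.
    - rewrite /p expg1 (can2_eq (conjgK s) (conjgKV s)) conjgE !sV.
      by rewrite !mulgA.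
    - apply: eq_bigr => i _; congr (nat_of_bool _).
      by rewrite (can2_eq (conjgK _) (conjgKV _)) pJ.
  have f2 k : ((f s * f t) ^+ k).2 = (s * t) ^+ k.
    by elim: k => // k IHk; rewrite !expgS /= IHk.
  have pn i : p (n + i)%N = p i by rewrite /p expgnDr stn mul1g.
  rewrite [LHS]surjective_pairing f2 stn; congr (_, _).
  apply/fsetP => x; rewrite stE mul2n -addnn big_split_ord /= oddD.
  by under [X in odd X (+) _]eq_bigr do rewrite -pn; rewrite addbb.
exists (fun w => (h w).1); split=> //.
  by move=> s sS; rewrite hf.
have h2 w : (h w).2 = w.
  have : parabolic S w by rewrite gen.
  move: w; apply: parabolic_ind => // [|s w sS _ IHw]; first by rewrite multiplicative1.
  by rewrite gmulfM /= IHw hf.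
by move=> w v t; rewrite gmulfM /= in_fsymdiff in_conjf h2.
Qed.

(** * Length and descents *)

Section Length.
Variables (W : groupType) (S : {fset W}) (N : W -> {fset W}).
Hypothesis hN : inversion_cocycle S N.
Implicit Types (I J A : {fset W}) (w v s t x y : W).

Local Notation len w := (#|` N w%g|).

Lemma cocycle_involutive s : s \in S -> s * s = 1.
Proof. by case: hN => + _ _; apply. Qed.

Lemma cocycle_genV s : s \in S -> s^-1 = s.
Proof. by move=> sS; rewrite -[LHS]mulg1 -(cocycle_involutive sS) mulKg. Qed.

Lemma cocycle_genK s w : s \in S -> s * (s * w) = w.
Proof. by move=> sS; rewrite mulgA cocycle_involutive // mul1g. Qed.

Lemma cocycle_gen s : s \in S -> N s = [fset s].
Proof. by case: hN => _ + _; apply. Qed.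

Lemma cocycleM w v t : (t \in N (w * v)) = (t \in N w) (+) (t ^ w \in N v).
Proof. by case: hN => _ _ h; rewrite h. Qed.

Lemma cocycle1 : N 1 = fset0.
Proof.
apply/fsetP => t; have := cocycleM 1 1 t; rewrite mulg1 conjg1 inE.
by case: (t \in N 1).
Qed.

Lemma cocycleV w t : (t \in N w^-1) = (t ^ w^-1 \in N w).
Proof.
have := cocycleM w^-1 w t; rewrite mulVg cocycle1 inE.
by case: (t \in N w^-1); case: (_ \in N w).
Qed.

Lemma cocycleV' w t : (t \in N w) = (t ^ w \in N w^-1).
Proof. by rewrite cocycleV conjgK. Qed.

Lemma lenV w : len w^-1 = len w.
Proof.
rewrite -(card_conjf w^-1 (N w)); congr #|` _|; apply/fsetP => t.
by rewrite cocycleV in_conjf.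
Qed.

(** [N (w * v)] is the symmetric difference of [N w] and w (N v) w^-1, so each common wall is lost
    from both. *)
Lemma lenM w v :
  (len (w * v) + 2 * #|` N w `&` conjf w (N v)| = len w + len v)%N.
Proof.
 have -> : N (w * v) = fsymdiff (N w) (conjf w (N v)).
  by apply/fsetP => t; rewrite in_fsymdiff in_conjf cocycleM.
rewrite -(card_conjf w (N v)) /fsymdiff.
set A := N w; set B := conjf w _.
have dis : (A `\` B) `&` (B `\` A) = fset0.
  by apply/fsetP => t; rewrite !inE; case: (t \in A); case: (t \in B).
rewrite cardfsU dis cardfs0 subn0 -(cardfsID B A) -[X in (_ = _ + X)%N](cardfsID A B).
by rewrite [B `&` A]fsetIC; lia.
Qed.

Lemma len_le w v : (len (w * v) <= len w + len v)%N.
Proof. by have := lenM w v; lia. Qed.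

Lemma len_odd w v : odd (len (w * v)) = odd (len w) (+) odd (len v).
Proof. by rewrite -oddD -lenM oddD mul2n odd_double addbF. Qed.

Lemma len_add_sub w v : (len w + len v <= len (w * v))%N -> N w `<=` N (w * v).
Proof.
move=> h; have /eqP : #|` N w `&` conjf w (N v)| = 0%N by have := lenM w v; lia.
rewrite cardfs_eq0 => /eqP /fsetP h0; apply/fsubsetP => t tw.
by have := h0 t; rewrite cocycleM !inE tw in_conjf /= => ->.
Qed.

Lemma len_add w v : (forall t, t \in N v -> t \notin N w^-1) ->
  len (w * v) = (len w + len v)%N.
Proof.
move=> h; rewrite -lenM; suff -> : N w `&` conjf w (N v) = fset0.
  by rewrite cardfs0 muln0 addn0.
apply/fsetP => t; rewrite !inE in_conjf cocycleV'; apply/andP => -[tw tv].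
by move: (h _ tv); rewrite tw.
Qed.

Lemma len_descent s w : s \in S -> s \in N w -> len w = (len (s * w)).+1.
Proof.
move=> sS sw; rewrite -{1}(cocycle_genK w sS) -add1n -(cardfs1 s).
rewrite -(cocycle_gen sS) [LHS]len_add // => t; rewrite cocycle_genV //.
rewrite cocycleM cocycle_gen // inE => h; apply: contraL h => /eqP ->.
by rewrite eqxx conjgE mulKg sw.
Qed.

Lemma len_ascent s w : s \in S -> s \notin N w -> len (s * w) = (len w).+1.
Proof.
move=> sS sw; rewrite (@len_descent s (s * w)) ?cocycle_genK //.
by rewrite cocycleM cocycle_gen // inE eqxx conjgE mulKg (negbTE sw).
Qed.

Lemma len_ltP s w : s \in S -> (s \in N w) = (len (s * w) <= len w)%N.
Proof.
move=> sS; case: (boolP (s \in N w)) => h.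
  by rewrite (len_descent sS h) leqW.
by rewrite (len_ascent sS h) ltnn.
Qed.

Let wprod (p : seq W) := \prod_(s <- p) s.

Lemma len_word p : {subset p <= S} -> (len (wprod p) <= size p)%N.
Proof.
elim: p => [|s p IHp] pS; first by rewrite /wprod big_nil cocycle1 cardfs0.
rewrite /wprod big_cons; apply: (leq_trans (len_le _ _)).
rewrite cocycle_gen ?cardfs1 ?pS ?mem_head // add1n ltnS; apply: IHp.
by move=> x xp; apply: pS; rewrite inE xp orbT.
Qed.

(** Strong exchange: a reflection in [N] of s_1 ... s_k equals s_1 ... s_i ... s_1 for some i, and
    multiplying by it on the left deletes the letter s_i. *)
Lemma word_deletion p t : {subset p <= S} -> t \in N (wprod p) ->
  exists p', [/\ {subset p' <= S}, (size p' < size p)%N & t * wprod p = wprod p'].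
Proof.
elim: p t => [|s p IHp] t pS; first by rewrite /wprod big_nil cocycle1.
have sS : s \in S by rewrite pS ?mem_head.
have pS' : {subset p <= S} by move=> x xp; rewrite pS // inE xp orbT.
rewrite /wprod big_cons cocycleM cocycle_gen // inE.
have [-> _|_] := eqVneq t s.
  by exists p; split=> //; rewrite cocycle_genK.
rewrite addFb => /IHp[//|p' [p'S lt_p' e]]; exists (s :: p'); split=> //.
  by move=> x; rewrite inE => /orP[/eqP ->|/p'S].
by rewrite big_cons -[X in _ = s * X]e conjgE cocycle_genV // !mulgA
  cocycle_involutive // mul1g.
Qed.

Lemma word_parabolic w : parabolic S w ->
  exists2 p, {subset p <= S} & w = wprod p.
Proof.
move: w; apply: parabolic_ind => [||s w sS _ [p pS ->]]; first exact: cocycle_involutive.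
  by exists [::] => //; rewrite /wprod big_nil.
exists (s :: p); last by rewrite /wprod big_cons.
by move=> x; rewrite inE => /orP[/eqP ->|/pS].
Qed.

(** When the first letter s is a descent of the reduced word found for the remaining letters,
    exchange gives a strictly shorter word for the whole product, to which the induction on the
    number of letters applies. *)
Lemma reduced_word w : parabolic S w ->
  exists p, [/\ {subset p <= S}, w = wprod p & size p = len w].
Proof.
move=> /word_parabolic[p0 p0S ->] {w}.
elim/ltn_ind: {p0}(size p0) {-2}p0 (leqnn (size p0)) p0S => n IHn p + pS.
case: p pS => [|s p] pS sz.
  by exists [::]; split=> //; rewrite /wprod big_nil cocycle1 cardfs0.
have sS : s \in S by rewrite pS ?mem_head.
have pS' : {subset p <= S} by move=> x xp; rewrite pS // inE xp orbT.
have [q [qS pq lq]] := IHn (size p) sz p (leqnn _) pS'.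
have e : wprod (s :: p) = s * wprod q by rewrite -pq /wprod big_cons.
case: (boolP (s \in N (wprod q))) => h; last first.
  exists (s :: q); split.
  - by move=> x; rewrite inE => /orP[/eqP ->|/qS].
  - by rewrite e /wprod big_cons.
  - by rewrite e len_ascent //= lq pq.
have [q' [q'S lt_q' eq']] := word_deletion qS h.
have lp : (size q <= size p)%N by rewrite lq len_word.
rewrite e eq'; apply: (IHn (size q')) => //.
by apply: leq_trans sz; rewrite /= ltnS ltnW // (leq_trans lt_q').
Qed.

(** No word for w has fewer letters than w has walls, and a reduced word attains this bound. As w is
    in W_S, the default value of [clength] is not reached. *)
Lemma clength_cocycle w : parabolic S w -> clength S w = len w.
Proof.
move=> wS; have [p [pS wp sp]] := reduced_word wS.
rewrite /clength; case: xgetP => [n _ [[q [sq qS wq]] nmin]|/(_ (len w)) []]; last first.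
  split; first by exists p; rewrite sp.
  by move=> m [q [<- qS ->]]; exact: len_word.
apply/eqP; rewrite eqn_leq nmin; last by exists p; rewrite sp.
by rewrite -sq wq len_word.
Qed.

Lemma exists_descent w : parabolic S w -> w <> 1 -> exists2 s, s \in S & s \in N w.
Proof.
move=> /reduced_word[[|s p] [pS -> sp]]; first by rewrite /wprod big_nil.
have sS : s \in S by rewrite pS ?mem_head.
move=> _; exists s => //; rewrite len_ltP // -sp /wprod big_cons cocycle_genK //.
apply: ltnW; rewrite ltnS; apply: len_word => x xp.
by rewrite pS // inE xp orbT.
Qed.

Lemma len_eq0 w : parabolic S w -> len w = 0%N -> w = 1.
Proof.
move=> wS w0; apply: contrapT => /(exists_descent wS)[s _].
by move/eqP: w0; rewrite cardfs_eq0 => /eqP ->.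
Qed.

Lemma reflection_descent w t : parabolic S w -> t \in N w -> (len (t * w) < len w)%N.
Proof.
move=> /reduced_word[p [pS -> sp]] /(word_deletion pS)[q [qS lt_q ->]].
by rewrite -sp (leq_ltn_trans _ lt_q) // len_word.
Qed.

Lemma cocycle_parabolic w t : parabolic S w -> t \in N w -> parabolic S t.
Proof.
move=> wS; move: w wS t; apply: parabolic_ind; first exact: cocycle_involutive.
  by move=> t; rewrite cocycle1.
move=> s w sS wS IHw t; rewrite cocycleM cocycle_gen // inE.
have [-> _|_ /IHw] := eqVneq t s; first exact: parabolic_gen.
rewrite conjgE => /parabolicMl h; move: h.
by rewrite cocycle_genV // => /(_ (parabolic_gen sS)) /parabolicMr; apply;
  exact: parabolic_gen.
Qed.

Lemma descent_ind (Q : W -> Prop) :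
    Q 1 -> (forall s w, s \in S -> s \notin N w -> parabolic S w -> Q w -> Q (s * w)) ->
  forall w, parabolic S w -> Q w.
Proof.
move=> Q1 QM w; have [n] := ubnP (len w); elim: n w => // n IHn w lew wS.
have [->//|/eqP w1] := eqVneq w 1.
have [s sS sw] := exists_descent wS w1.
have lsw := len_descent sS sw.
rewrite -(cocycle_genK w sS); apply: QM => //.
- by rewrite cocycleM cocycle_gen // inE eqxx conjgE mulKg sw.
- by apply: parabolicM => //; exact: parabolic_gen.
- by apply: IHn; [rewrite -ltnS -lsw | apply: parabolicM => //; exact: parabolic_gen].
Qed.

End Length.

Lemma exists_argmin (T : Type) (Q : T -> Prop) (f : T -> nat) :
  (exists x, Q x) -> exists x, Q x /\ forall y, Q y -> (f x <= f y)%N.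
Proof.
move=> [x0 Qx0].
have h : exists n, `[< exists2 x, Q x & f x = n >].
  by exists (f x0); apply/asboolP; exists x0.
case: (ex_minnP h) => n /asboolP[x Qx fx] nmin; exists x; split=> // y Qy.
by rewrite fx; apply: nmin; apply/asboolP; exists y.
Qed.

(* y is shortest in W_I y; shortest elements x of the cosets x W_I are those
   with lmin N I x^-1. *)
Definition lmin (W : groupType) (N : W -> {fset W}) (I : {fset W}) (y : W) :=
  all (fun s => s \notin N y) I.

(** * Cosets of parabolic subgroups *)

Section Cosets.
Variables (W : groupType) (S : {fset W}) (N : W -> {fset W}).
Hypothesis hN : inversion_cocycle S N.
Implicit Types (I J A : {fset W}) (w v s t x y u : W).

Local Notation len w := (#|` N w%g|).

(** Here m is a shortest element of W_I w: an element of W_I in [N m] would shorten it further. *)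
Lemma coset_decomp I w : I `<=` S -> parabolic S w ->
  exists u m, [/\ parabolic I u, parabolic S m, w = u * m &
    forall t, parabolic I t -> t \notin N m].
Proof.
move=> IS wS.
have [|m [[u uI um] mmin]] :=
    @exists_argmin _ (fun m => exists2 u, parabolic I u & w = u * m) (fun m => len m).
  by exists w, 1; rewrite ?mul1g //; exact: parabolic1.
have mS : parabolic S m.
  by apply/(parabolicMl m (parabolicS IS uI)); rewrite -um.
exists u, m; split=> // t tI; apply/negP => /(reflection_descent hN mS).
apply/negP; rewrite -leqNgt; apply: mmin; exists (u * t^-1).
  by apply: parabolicM => //; apply/parabolicV.
by rewrite -mulgA mulKg.
Qed.

(** In y = u * m with m shortest in W_I y, a left descent s of u in I would be one of y, because s ^
    u lies in W_I and hence outside [N m]. So u = 1, and the condition on generators extends to all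
    of W_I. *)
Lemma lmin_parabolic I y t : I `<=` S -> parabolic S y -> lmin N I y ->
  parabolic I t -> t \notin N y.
Proof.
move=> IS yS /allP ymin; have [u [m [uI mS yE mmin]]] := coset_decomp IS yS.
suff u1 : u = 1 by rewrite yE u1 mul1g; apply: mmin.
apply: contrapT => /(exists_descent (sub_cocycle hN IS) uI)[s sI su].
have := ymin _ sI; rewrite yE (cocycleM hN) su /= negbK => /negP; apply; apply/negP.
apply: mmin; rewrite conjgE; apply/parabolicMl; first exact/parabolicV.
by apply: parabolicM => //; exact: parabolic_gen.
Qed.

Lemma lmin_add I u y : I `<=` S -> parabolic S y -> lmin N I y ->
  parabolic I u -> len (u * y) = (len u + len y)%N.
Proof.
move=> IS yS ymin uI; apply: (len_add hN) => t ty.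
apply: contraL ty => /(cocycle_parabolic (sub_cocycle hN IS)) h.
by apply: (lmin_parabolic IS yS ymin); apply: h; exact/parabolicV.
Qed.

Lemma lmin_sub I u y : I `<=` S -> parabolic S y -> lmin N I y ->
  parabolic I u -> N u `<=` N (u * y).
Proof. by move=> IS yS ym uI; apply: (len_add_sub hN); rewrite (lmin_add IS). Qed.

Lemma lmin_decomp I w : I `<=` S -> parabolic S w ->
  exists u y, [/\ parabolic I u, parabolic S y, lmin N I y & w = u * y].
Proof.
move=> IS /(coset_decomp IS)[u [m [uI mS wE h]]]; exists u, m; split=> //.
by apply/allP => s sI; apply: h; exact: parabolic_gen.
Qed.

Lemma lmin_uniq I u y y' : I `<=` S -> parabolic S y -> parabolic S y' ->
  lmin N I y -> lmin N I y' -> parabolic I u -> y' = u * y -> y' = y.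
Proof.
move=> IS yS y'S ym ym' uI e; suff u1 : u = 1 by rewrite e u1 mul1g.
apply: contrapT => /(exists_descent (sub_cocycle hN IS) uI)[s sI su].
have := allP ym' s sI; rewrite e => /negP; apply.
by apply: (fsubsetP (lmin_sub IS yS ym uI)).
Qed.

Lemma gen_parabolic I s : I `<=` S -> s \in S -> parabolic I s -> s \in I.
Proof.
move=> IS sS sI; have s1 : s <> 1.
  move=> s1; have := cocycle_gen hN sS; rewrite s1 (cocycle1 hN) => /fsetP/(_ 1).
  by rewrite !inE eqxx.
have [t tI] := exists_descent (sub_cocycle hN IS) sI s1.
by rewrite (cocycle_gen hN sS) inE => /eqP <-.
Qed.

Lemma descent_parabolic I s w : I `<=` S -> s \in S -> s \in N w -> parabolic I w ->
  s \in I.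
Proof.
move=> IS sS sw wI; apply: gen_parabolic => //.
exact: (cocycle_parabolic (sub_cocycle hN IS) wI sw).
Qed.

(** Left descents of an element of W_J lie in J, so an element of both groups can be written by
    removing letters that belong to both sets. *)
Lemma parabolicI I J w : I `<=` S -> J `<=` S ->
  parabolic I w -> parabolic J w -> parabolic (I `&` J) w.
Proof.
move=> IS JS wI; have hI := sub_cocycle hN IS; move: w wI.
apply: (descent_ind hI) => [_|s w sI sw wI IHw swJ]; first exact: parabolic1.
have sJ : s \in J.
  apply: (descent_parabolic JS (fsubsetP IS _ sI)) swJ.
  by rewrite (cocycleM hI) (cocycle_gen hI) // inE eqxx conjgE mulKg (negbTE sw).
apply: parabolicM; first by apply: parabolic_gen; rewrite inE sI.
by apply: IHw; move/(parabolicMl w (parabolic_gen sJ)): swJ.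
Qed.

Lemma rmin_parabolic I x t : I `<=` S -> parabolic S x -> lmin N I x^-1 ->
  parabolic I (t ^ x) -> t \notin N x.
Proof.
move=> IS /parabolicV xS xm tI; rewrite (cocycleV' hN).
exact: (lmin_parabolic IS xS xm).
Qed.

Lemma rmin_decomp I w : I `<=` S -> parabolic S w ->
  exists x u, [/\ parabolic S x, parabolic I u, lmin N I x^-1 & w = x * u].
Proof.
move=> IS /parabolicV/(lmin_decomp IS)[u [y [uI yS ym e]]].
exists y^-1, u^-1; split; rewrite ?invgK //; try exact/parabolicV.
by apply: invg_inj; rewrite e invgM !invgK.
Qed.

Lemma rmin_uniq I u x x' : I `<=` S -> parabolic S x -> parabolic S x' ->
  lmin N I x^-1 -> lmin N I x'^-1 -> parabolic I u -> x' = x * u -> x' = x.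
Proof.
move=> IS /parabolicV xS /parabolicV x'S xm xm' /parabolicV uI e; apply: invg_inj.
by apply: (lmin_uniq IS xS x'S xm xm' uI); rewrite e invgM.
Qed.

Lemma rmin_add I u x : I `<=` S -> parabolic S x -> lmin N I x^-1 ->
  parabolic I u -> len (x * u) = (len x + len u)%N.
Proof.
move=> IS /parabolicV xS xm /parabolicV uI.
by rewrite -[LHS](lenV hN) invgM (lmin_add IS xS xm uI) !(lenV hN) addnC.
Qed.

(** Induction on u by left ascents s. As s is a descent of w but not of u, the reflection s ^ u lies
    in [N (u^-1 * w)] and shortens u^-1 * w to u^-1 * s * w. The triangle inequality for w as the
    product of s * u and u^-1 * s * w then forces equality. *)
Lemma longest_add w u : S `<=` N w -> parabolic S w -> parabolic S u ->
  len w = (len u + len (u^-1 * w))%N.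
Proof.
move=> /fsubsetP Sw wS; move: u; apply: (descent_ind hN) => [|s u sS su uS IHu].
  by rewrite (cocycle1 hN) cardfs0 invg1 mul1g.
rewrite (len_ascent hN sS su) invgM (cocycle_genV hN sS).
have lw : w = u * (u^-1 * w) by rewrite mulVKg.
have := Sw s sS; rewrite {1}lw (cocycleM hN) (negbTE su) /= => h.
have gS : parabolic S (u^-1 * w) by apply: parabolicM => //; exact/parabolicV.
have := reflection_descent hN gS h; rewrite conjgE => lt1.
have e : u^-1 * (s * u) * (u^-1 * w) = u^-1 * s * w by rewrite !mulgA mulgK.
rewrite e in lt1.
have l2 : (len w <= len (s * u) + len (u^-1 * s * w))%N.
  have e2 : w = s * u * (u^-1 * s * w).
    by rewrite !mulgA mulgK (cocycle_involutive hN sS) mul1g.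
  by rewrite {1}e2; exact: (len_le hN).
rewrite (len_ascent hN sS su) in l2.
move: IHu lt1 l2; move: (len w) (len u) (len (u^-1 * w)) (len (u^-1 * s * w)) => a b
  c d; lia.
Qed.

Lemma longest_max w u : S `<=` N w -> parabolic S w -> parabolic S u ->
  (len u <= len w)%N.
Proof. by move=> Sw wS uS; rewrite (longest_add Sw wS uS) leq_addr. Qed.

Lemma longest_uniq w u : S `<=` N w -> parabolic S w -> S `<=` N u -> parabolic S u ->
  u = w.
Proof.
move=> Sw wS Su uS; have h := longest_add Sw wS uS.
have l0 : len (u^-1 * w) = 0%N by have := longest_max Su uS wS; lia.
have /(len_eq0 hN)/(_ l0) e : parabolic S (u^-1 * w).
  by apply: parabolicM => //; exact/parabolicV.
by rewrite -[RHS](mulVKg u) e mulg1.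
Qed.

Lemma longest_sub w u : S `<=` N w -> parabolic S w -> parabolic S u -> N u `<=` N w.
Proof.
move=> Sw wS uS; rewrite -(mulVKg u w).
by apply: (len_add_sub hN); rewrite mulVKg (longest_add Sw wS uS).
Qed.

Lemma longestV w : S `<=` N w -> parabolic S w -> w^-1 = w.
Proof.
move=> Sw wS; apply: (longest_uniq Sw) => //; last exact/parabolicV.
apply/fsubsetP => s sS.
have wVS : parabolic S w^-1 by exact/parabolicV.
rewrite (len_ltP hN) // (lenV hN).
by apply: longest_max => //; apply: parabolicM => //; exact: parabolic_gen.
Qed.

End Cosets.

(** * Twisted involutions *)

Section Twisted.
Variables (W : groupType) (S : {fset W}) (N : W -> {fset W}).
Hypothesis hN : inversion_cocycle S N.
Variable star : {multiplicative W -> W}.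
Hypothesis hs : involutive star.
Hypothesis hS : star_stable star S.
Implicit Types (I J A : {fset W}) (w v s t x y u z : W).

Local Notation len w := (#|` N w%g|).

Lemma star_stableP J : reflect (forall s, (star s \in J) = (s \in J)) (star_stable
  star J).
Proof.
apply: (iffP eqP) => [JE s|h].
  have sub r : r \in J -> star r \in J by move=> rJ; rewrite -JE in_imfset.
  by apply/idP/idP => /sub //; rewrite hs.
apply/fsetP => s; apply/imfsetP/idP => [[t /= tJ ->]|sJ]; first by rewrite h.
by exists (star s) => /=; rewrite ?h ?hs.
Qed.

Lemma parabolic_star J w : star_stable star J -> J `<=` S ->
  parabolic J (star w) <-> parabolic J w.
Proof.
move=> /star_stableP Jst JS.
have sub v : parabolic J v -> parabolic J (star v).
  move: v; apply: parabolic_ind => [s sJ||s v sJ _ h].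
  - by apply: (cocycle_involutive (sub_cocycle hN JS)).
  - by rewrite multiplicative1; exact: parabolic1.
  - by rewrite gmulfM; apply: parabolicM => //; apply: parabolic_gen; rewrite Jst.
by split=> /sub //; rewrite hs.
Qed.

Lemma cocycle_star w t : parabolic S w -> (star t \in N (star w)) = (t \in N w).
Proof.
move=> wS; move: w wS t; apply: parabolic_ind => [s sS|t|s w sS _ IHw t].
- exact: (cocycle_involutive hN).
- by rewrite multiplicative1 (cocycle1 hN).
have ssS : star s \in S by rewrite (star_stableP S hS).
rewrite gmulfM !(cocycleM hN) -multiplicativeJ IHw (cocycle_gen hN sS) (cocycle_gen
  hN ssS).
by rewrite !inE (inv_eq hs) hs.
Qed.

Lemma len_star w : parabolic S w -> len (star w) = len w.
Proof.
move=> wS.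
have <- : #|` [fset star t | t in N w]| = len w.
  by apply: card_imfset; apply: inv_inj.
congr #|` _|.
apply/fsetP => t; apply/idP/imfsetP => [h|[r /= rw ->]]; last by rewrite cocycle_star.
by exists (star t); rewrite ?hs //= -cocycle_star ?hs.
Qed.

Lemma lmin_star J x : star_stable star J -> parabolic S x ->
  lmin N J (star x) = lmin N J x.
Proof.
move=> /star_stableP Jst xS; apply/allP/allP => h s sJ.
  by rewrite -cocycle_star // h ?Jst.
by rewrite -(hs s) cocycle_star // h ?Jst.
Qed.

(** Write z = u * m with u in W_J and m shortest in W_J z. A right descent s of m is one of z, so
    star s is a left descent of z and lies in J. Commutation turns m * s * m^-1 into a conjugate of
    star s by u, an element of W_J in [N m], against the minimality of m; so m = 1. *)
Lemma twisted_descents z : parabolic S z -> star z = z^-1 ->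
    (forall s, s \in S -> s \in N z -> s * z = z * star s) ->
  let J := S `&` N z in
  [/\ parabolic J z, star_stable star J & forall w, parabolic J w -> w * z = z * star w].
Proof.
move=> zS zst zcomm J; have JS : J `<=` S by exact: fsubsetIl.
have [u [m [uJ mS mm ze]]] := lmin_decomp hN JS zS.
have zJ : parabolic J z.
  suff m1 : m = 1 by rewrite ze m1 mulg1.
  have mVS : parabolic S m^-1 by exact/parabolicV.
  suff mV1 : m^-1 = 1 by rewrite -(invgK m) mV1 invg1.
  apply: contrapT => /(exists_descent hN mVS)[s sS sm].
  have sz : s \in N (star z).
    rewrite zst ze invgM; apply: (fsubsetP (len_add_sub hN _)) sm.
    by rewrite -invgM !(lenV hN) (lmin_add hN JS mS mm uJ) addnC.
  have ssJ : star s \in J.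
    by rewrite inE (star_stableP S hS) sS -cocycle_star ?hs.
  have [ssS ssz] : star s \in S /\ star s \in N z by move: ssJ; rewrite inE => /andP.
  have e : star s * z = z * s by rewrite zcomm // hs.
  have tJ : parabolic J (s ^ m^-1).
    have -> : s ^ m^-1 = (star s) ^ u.
      have sE : s = z^-1 * (star s * z) by rewrite e mulKg.
      rewrite !conjgE invgK [in LHS]sE ze invgM.
      by rewrite -!mulgA mulVKg mulgV mulg1.
    rewrite conjgE; apply/parabolicMl; first exact/parabolicV.
    by apply: parabolicM => //; exact: parabolic_gen.
  have := lmin_parabolic hN JS mS mm tJ.
  by rewrite -(cocycleV hN) sm.
have sub s : s \in J -> star s \in J.
  rewrite inE => /andP[sS sz]; apply: (gen_parabolic hN JS).
    by rewrite (star_stableP S hS).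
  have -> : star s = z^-1 * (s * z) by rewrite zcomm // mulKg.
  apply/parabolicMl; first exact/parabolicV.
  by apply: parabolicM => //; apply: parabolic_gen; rewrite inE sS.
split=> //.
  by apply/star_stableP => s; apply/idP/idP => /sub //; rewrite hs.
apply: parabolic_ind => [s /(fsubsetP JS)||s w].
- exact: (cocycle_involutive hN).
- by rewrite multiplicative1 mul1g mulg1.
by rewrite inE => /andP[sS sz] _ e; rewrite gmulfM -mulgA e !mulgA zcomm.
Qed.

Lemma twisted_conj z x : star z = z^-1 ->
  star (x^-1 * z * star x) = (x^-1 * z * star x)^-1.
Proof. by move=> zst; rewrite !gmulfM hs multiplicativeV zst !invgM invgK mulgA. Qed.

Lemma parabolic_twist I z x : star_stable star I -> I `<=` S -> parabolic I z ->
  parabolic I x -> parabolic I (x^-1 * z * star x).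
Proof.
move=> Ist IS zI xI; apply: parabolicM; last exact/parabolic_star.
by apply: parabolicM => //; exact/parabolicV.
Qed.

(** Induction on length: a descent s with s * z different from z * star s yields the shorter twisted
    involution s * z * star s, and the conjugators multiply. *)
Lemma twisted_reduction z : parabolic S z -> star z = z^-1 ->
  exists v, let z0 := v^-1 * z * star v in
  [/\ parabolic S v, len z = (2 * len v + len z0)%N &
    forall s, s \in S -> s \in N z0 -> s * z0 = z0 * star s].
Proof.
have [n] := ubnP (len z); elim: n z => // n IHn z lz zS zst.
have [h|] := pselect (forall s, s \in S -> s \in N z -> s * z = z * star s).
  exists 1; rewrite invg1 mul1g multiplicative1 mulg1; split=> //;
    first exact: parabolic1.
  by rewrite (cocycle1 hN) cardfs0.
move/existsNP => [s] /not_implyP[sS] /not_implyP[sz /eqP ne].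
have stS : star s \in S by rewrite (star_stableP S hS).
have sV := cocycle_genV hN sS; have stV := cocycle_genV hN stS.
have l1 := len_descent hN sS sz.
have zsV : z * star s = star (s * z)^-1.
  by rewrite multiplicativeV gmulfM zst !invgM invgK stV.
have szS : parabolic S (s * z) by apply: parabolicM => //; exact: parabolic_gen.
have l2 : len (z * star s) = len (s * z).
  by rewrite zsV len_star ?(lenV hN) //; exact/parabolicV.
(* star s is a right descent of z. It remains one of s * z unless z * star s * z^-1 = s, which is
   the excluded commutation. *)
have l3 : len (s * z) = (len (s * z * star s)).+1.
  have t0z : star s ^ z^-1 \in N z.
    rewrite -(cocycleV hN) (len_ltP hN) //.
    by rewrite -{1}stV -invgM !(lenV hN) l2 l1.
  rewrite -(lenV hN (s * z)) (len_descent hN stS); last first.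
    rewrite (cocycleV hN) (cocycleM hN) (cocycle_gen hN) // inE invgM conjgM.
    rewrite conjgKV t0z addbT (can2_eq (conjgKV s) (conjgK s)).
    rewrite [s ^ s]conjgE mulKg; apply: contra ne => /eqP e.
    by rewrite -{1}e conjgE invgK -!mulgA mulVg mulg1.
  by rewrite -{1}stV -invgM (lenV hN).
set z1 := s * z * star s in l3.
have z1E : z1 = s^-1 * z * star s by rewrite sV.
have z1st : star z1 = z1^-1 by rewrite z1E; exact: twisted_conj.
have z1S : parabolic S z1 by apply: parabolicM => //; exact: parabolic_gen.
have lz1' : len z1 < n by move: lz; rewrite l1 l3 ltnS => /ltnW.
have [v] := IHn z1 lz1' z1S z1st; cbv zeta.
have -> : v^-1 * z1 * star v = (s * v)^-1 * z * star (s * v).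
  by rewrite z1E gmulfM invgM !mulgA.
cbv zeta; move=> [vS lz1 hv]; exists (s * v); split=> //.
  by apply: parabolicM => //; exact: parabolic_gen.
(* Only this upper bound on the length of s * v is immediate; the triangle inequality for z gives
   the opposite bound and hence equality. *)
have lsv : (len (s * v) <= (len v).+1)%N.
  by apply: (leq_trans (len_le hN _ _)); rewrite (cocycle_gen hN) // cardfs1.
have lz' : (len z <= 2 * len (s * v) + len ((s * v)^-1 * z * star (s * v)))%N.
  set g := (s * v)^-1 * _ * _.
  have svS : parabolic S (s * v) by apply: parabolicM => //; exact: parabolic_gen.
  have -> : z = s * v * g * (star (s * v))^-1.
    by rewrite /g !mulgA mulgV mul1g mulgK.
  apply: (leq_trans (len_le hN _ _)); rewrite (lenV hN) (len_star svS).
  by rewrite mul2n -addnn addnAC leq_add2r (len_le hN).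
move: l1 l3 lz1 lsv lz'; move: (len z) (len _) (len _) (len _) (len _) => a b c d e; lia.
Qed.

Lemma parabolic_unit_len I r : I `<=` S -> parabolic I r -> len r = 1%N -> r \in I.
Proof.
move=> IS rI r1; have hI := sub_cocycle hN IS.
have [|s sI sr] := exists_descent hI rI.
  by move=> e; move: r1; rewrite e (cocycle1 hN) cardfs0.
have := len_descent hI sI sr; rewrite r1 => -[/esym/(len_eq0 hI) e].
rewrite -(cocycle_genK hI r sI) e ?mulg1 //.
by apply: parabolicM => //; exact: parabolic_gen.
Qed.

(** The cocycle of z = x * u * (star x)^-1 expresses [N z] through the involution [phi], which
    exchanges the contributions of x and star x. Outside [B], a reflection t lies in [N z] when
    exactly one of t and [phi t] lies in [N x], so these walls come in pairs. *)
Lemma twisted_weight I z x : I `<=` S -> parabolic S z -> star z = z^-1 ->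
    parabolic S x -> lmin N I x^-1 -> parabolic I (x^-1 * z * star x) ->
  (2 * len x + len (x^-1 * z * star x) = len z + 2 * #|` N x `\` N z|)%N.
Proof.
move=> IS zS zst xS xm; set u := x^-1 * z * star x => uI.
have uS := parabolicS IS uI.
have ust : star u = u^-1 by exact: twisted_conj.
pose phi t := star (t ^ z).
have phiK : involutive phi.
  by move=> t; rewrite /phi multiplicativeJ hs -conjgM zst mulgV conjg1.
have zE : z = x * (u * (star x)^-1) by rewrite /u !mulgA mulgV mul1g mulgK.
have Nz t : (t \in N z) = (t \in N x) (+) ((t ^ x \in N u) (+) (phi t \in N x)).
  rewrite -(cocycle_star (phi t) xS) /phi hs {1}zE (cocycleM hN x) (cocycleM hN u)
    (cocycleV hN).
  by rewrite -!conjgM -?[x * u * _]mulgA -zE.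
have bA t : t ^ x \in N u -> t \notin N x.
  by move=> h; apply: (rmin_parabolic hN IS) => //;
    apply: (cocycle_parabolic (sub_cocycle hN IS) uI).
have bphi t : (phi t ^ x \in N u) = (t ^ x \in N u).
  have -> : phi t ^ x = star ((t ^ x) ^ u).
    rewrite /phi -[in LHS](hs x) -multiplicativeJ -!conjgM; congr (star (_ ^ _)).
    by rewrite /u !mulgA mulgV mul1g.
  by rewrite -{2}(invgK u) -ust -multiplicativeV cocycle_star ?(cocycleV hN) ?conjgK
    //; exact/parabolicV.
(* N z is the disjoint union of the walls B of x W_I and of X and phi X. *)
pose X := N x `&` N z; pose B := conjf x (N u).
have cB : #|` B| = len u by exact: card_conjf.
have NzE : N z = B `|` (X `|` [fset phi t | t in X]).
  apply/fsetP => t; rewrite !inE in_conjf.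
  have -> : (t \in [fset phi t | t in X]) = (phi t \in X).
    apply/imfsetP/idP => [[r /= rX ->]|h]; first by rewrite phiK.
    by exists (phi t); rewrite ?phiK.
  have := bA t; have := bA (phi t); rewrite bphi !inE !Nz phiK bphi.
  by case: (t ^ x \in N u); case: (t \in N x); case: (phi t \in N x) => // + + ;
    do ?[by move=> /(_ isT)]; do ?[by move=> _ /(_ isT)].
have dXY : X `&` [fset phi t | t in X] = fset0.
  apply/fsetP => t; rewrite !inE; apply/negP => /andP[/andP[tx tz]].
  move=> /imfsetP[r /=]; rewrite inE => /andP[rx rz] tr.
  move: rz; rewrite Nz rx -tr tx; have := bA _ _; move=> /(_ r).
  by case: (r ^ x \in N u) => // /(_ isT); rewrite rx.
have dB : B `&` (X `|` [fset phi t | t in X]) = fset0.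
  apply/fsetP => t; rewrite !inE in_conjf; apply/negP => /andP[tu].
  rewrite (negbTE (bA _ tu)) /= => /imfsetP[r /=]; rewrite inE => /andP[rx _] tr.
  by have := bA (phi t); rewrite bphi tr phiK rx => /(_ _)/negP; apply => //; rewrite -tr.
have cX : #|` [fset phi t | t in X]| = #|` X| by apply: card_imfset; apply: inv_inj.
have lz : len z = (len u + 2 * #|` X|)%N.
  by rewrite NzE cardfsU dB cardfs0 subn0 cB cardfsU dXY cardfs0 subn0 cX mul2n addnn.
have := cardfsID (N z) (N x); rewrite -/X lz => <-; lia.
Qed.

(** A wall distinguishing x from v * x' is the conjugate of a wall of b and so cuts their common
    coset of W_I. It is not in [N x] since x is shortest there; outside [N z], hence outside [N v],
    it is not in [N (v * x')] since x' is shortest in its coset. *)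
Lemma rmin_walls I z v x x' b : I `<=` S -> parabolic S x -> parabolic S x' ->
    parabolic I b -> lmin N I x^-1 -> lmin N I x'^-1 -> x = v * x' * b ->
    N v `<=` N z ->
  N x `\` N z = N (v * x') `\` N z.
Proof.
move=> IS xS x'S bI xm x'm xE /fsubsetP vz; apply/fsetP => t; rewrite !inE.
have [//|tz /=] := boolP (t \in N z).
have tv : t \notin N v by apply: contra tz; exact: vz.
case: (boolP (t ^ (v * x') \in N b)) => tb; last first.
  by rewrite xE [in LHS](cocycleM hN) (negbTE tb) addbF.
have tI : parabolic I (t ^ (v * x')) by exact: (cocycle_parabolic (sub_cocycle hN IS)
  bI tb).
have -> : t \in N x = false.
  apply/negbTE/(rmin_parabolic hN IS xS xm); rewrite xE conjgM conjgE.
  by apply/parabolicMl; [exact/parabolicV|exact: parabolicM].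
rewrite (cocycleM hN) (negbTE tv) /=; apply/esym/negbTE.
by apply: (rmin_parabolic hN IS x'S x'm); rewrite -conjgM.
Qed.

End Twisted.

(** * Extremal cosets and the longest element *)

Definition star_ascents (W : groupType) (N : W -> {fset W}) (star : W -> W)
    (S : {fset W}) (x : W) : {fset W} :=
  [fset s in S | (s \notin N x^-1) && (star s \notin N x^-1)].

Section Extremal.
Variables (W : groupType) (S : {fset W}) (N : W -> {fset W}).
Hypothesis hN : inversion_cocycle S N.
Variable star : {multiplicative W -> W}.
Hypothesis hs : involutive star.
Hypothesis hS : star_stable star S.
Implicit Types (I J A : {fset W}) (w v s t x y u z : W).

Local Notation len w := (#|` N w%g|).
Local Notation asc x := (star_ascents N star S x).

Lemma in_asc s x :
  (s \in asc x) = [&& s \in S, s \notin N x^-1 & star s \notin N x^-1].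
Proof. by rewrite !inE. Qed.

Lemma asc_sub x : asc x `<=` S.
Proof. by apply/fsubsetP => s; rewrite in_asc => /and3P[]. Qed.

Lemma asc_stable x : star_stable star (asc x).
Proof.
apply/(star_stableP hs) => s; rewrite !in_asc (star_stableP hs _ hS) hs.
by rewrite [X in _ && X]andbC.
Qed.

(** Thus [star_ascents] is the largest star-stable I for which x is shortest in x W_I. *)
Lemma lmin_asc I x : star_stable star I -> I `<=` S -> lmin N I x^-1 = (I `<=` asc x).
Proof.
move=> /(star_stableP hs) Ist /fsubsetP IS; apply/allP/fsubsetP => h s sI.
  by rewrite in_asc IS //= !h ?Ist.
by have := h _ sI; rewrite in_asc => /and3P[].
Qed.

Lemma lmin_asc_self x : lmin N (asc x) x^-1.
Proof. by rewrite lmin_asc ?asc_stable ?asc_sub. Qed.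

Section Extremum.
Variables (z0 x : W).
Hypotheses (zS : parabolic S z0) (zst : star z0 = z0^-1).
Hypothesis zcomm : forall s, s \in S -> s \in N z0 -> s * z0 = z0 * star s.
Hypothesis xS : parabolic S x.
Let A := asc x.
Let y := x^-1 * z0 * star x.
Hypothesis yA : parabolic A y.
Hypothesis ysupp : forall a, a \in A -> ~ parabolic (A `\` [fset a; star a]) y.

Let J := S `&` N z0.
Let JS : J `<=` S. Proof. exact: fsubsetIl. Qed.
Let AS : A `<=` S := asc_sub x.
Let hA := sub_cocycle hN AS.
Let xm : lmin N A x^-1 := lmin_asc_self x.
Let yst : star y = y^-1. Proof. exact: twisted_conj. Qed.

Let zxE : z0 * star x = x * y. Proof. by rewrite /y !mulgA mulgV mul1g. Qed.

Let zJ : parabolic J z0. Proof. by case: (twisted_descents hN hs hS zS zst zcomm). Qed.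
Let Jst : star_stable star J. Proof. by case: (twisted_descents hN hs hS zS zst
  zcomm). Qed.
Let Jcomm : forall w, parabolic J w -> w * z0 = z0 * star w.
Proof. by case: (twisted_descents hN hs hS zS zst zcomm) => _ _. Qed.
(** For t in W_J one has t ^ z0 = star t, so comparing the cocycles of the two sides of z0 * star x
    = x * y cancels the membership of t in [N x]. *)
Let zwall : forall t, t \in N z0 -> (t ^ x \in N y) /\ (t \notin N x).
Proof.
move=> t tz; have tJ : parabolic J t by exact: (cocycle_parabolic (sub_cocycle hN JS) zJ).
have e : t ^ z0 = star t by rewrite conjgE Jcomm // mulKg.
have := cocycleM hN z0 (star x) t.
rewrite zxE (cocycleM hN) tz e (cocycle_star hN hs hS) // => h.
have ty : t ^ x \in N y by move: h; case: (t \in N x); case: (_ \in N y).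
split=> //; apply: (rmin_parabolic hN AS xS xm).
exact: (cocycle_parabolic hA yA).
Qed.

(** No wall of x is a wall of z0, so the weight formula reduces to an equality of lengths. *)
Let len_y : len y = len z0.
Proof.
have := twisted_weight hN hs hS AS zS zst xS xm yA; rewrite -/y.
have -> : N x `\` N z0 = N x.
  apply/fsetDidPl; rewrite -fsetI_eq0; apply/eqP/fsetP => t; rewrite !inE.
  by apply/negP => /andP[tx /zwall[_]]; rewrite tx.
by move: (len _) (len _) (len _) => a b c; lia.
Qed.

(** Conjugation by x injects [N z0] into [N y]; equal cardinalities make it onto. *)
Let ywall : forall t, t \in N y -> t ^ x^-1 \in N z0.
Proof.
move=> r0; have sub : [fset t ^ x | t in N z0] `<=` N y.
  by apply/fsubsetP => _ /imfsetP[t /= tz ->]; case: (zwall tz).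
have c : #|` [fset t ^ x | t in N z0]| = len z0 by apply: card_imfset; exact: conjg_inj.
have /eqP <- : [fset t ^ x | t in N z0] == N y.
  by rewrite eqEfcard sub c len_y leqnn.
by move=> /imfsetP[r /= rz ->]; rewrite conjgK.
Qed.

Let xJm : lmin N J x.
Proof. by apply/allP => s; rewrite inE => /andP[_ /zwall[]]. Qed.

(** Lengths add on both sides of a ^ x^-1 * x = x * a, so the conjugate of a has length 1 and is
    simple. *)
Let ascent_conj : forall a, a \in A -> a \in N y -> a ^ x^-1 \in J.
Proof.
move=> a aA ay; apply: (parabolic_unit_len hN JS).
  exact: (cocycle_parabolic (sub_cocycle hN JS) zJ (ywall ay)).
have rJ : parabolic J (a ^ x^-1).
  exact: (cocycle_parabolic (sub_cocycle hN JS) zJ (ywall ay)).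
have l1 := lmin_add hN JS xS xJm rJ.
have l2 := rmin_add hN AS xS xm (parabolic_gen aA).
have e : a ^ x^-1 * x = x * a by rewrite conjgE invgK -!mulgA mulVg mulg1.
move: l1; rewrite e l2 (cocycle_gen hA aA) cardfs1.
by move: (len _) (len _) => b c; lia.
Qed.

Let ycomm : forall a, a \in A -> a \in N y -> a * y = y * star a.
Proof.
move=> a aA ay; have rJ := parabolic_gen (ascent_conj aA ay).
have -> : a * y = x^-1 * (a ^ x^-1 * z0) * star x.
  by rewrite conjgE invgK /y !mulgA mulVg mul1g.
by rewrite Jcomm // multiplicativeJ multiplicativeV conjgE invgK /y !mulgA mulgVK.
Qed.

(** The left descents of y form a star-stable set whose parabolic subgroup contains y; the full
    support [ysupp] forces every element of A to be among them. *)
Let yD : [/\ parabolic (S `&` N y) y, star_stable star (S `&` N y) & A `<=` N y].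
Proof.
have yS : parabolic S y := parabolicS AS yA.
have ND s : s \in S -> s \in N y -> s \in A.
  by move=> sS sy; exact: (descent_parabolic hN AS sS sy yA).
have [|yD Dst _] := twisted_descents hN hs hS yS yst.
  by move=> s sS sy; apply: ycomm => //; exact: ND.
split=> //; apply/fsubsetP => a aA; apply: contrapT => ay.
apply: (ysupp aA); apply: parabolicS yD; apply/fsubsetP => d.
rewrite inE => /andP[dS dy]; rewrite in_fsetD ND // andbT !inE negb_or.
apply/andP; split; first by apply/eqP => da; apply: ay; rewrite -da.
apply/eqP => da; have : star d \in S `&` N y by rewrite (star_stableP hs _ Dst) inE dS.
by rewrite da hs inE => /andP[_]; exact: ay.
Qed.

Lemma extremal_descents :
  [/\ A `<=` N y, {in A, forall a, a * y = y * star a} & len y = len z0].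
Proof. by case: yD => _ _ /fsubsetP Ay; split=> // [|a aA];
  [exact/fsubsetP|apply: ycomm => //; exact: Ay]. Qed.

(** star x is the product of z0^-1 * y ^ x^-1, an element of W_J, and x; both x and star x are
    shortest in W_J x. *)
Let xst : star x = x.
Proof.
have [_ _ /fsubsetP Ay] := yD.
have AJ w : parabolic A w -> parabolic J (w ^ x^-1).
  move: w; apply: parabolic_ind => [s sA||s w sA _ wJ];
    first exact: (cocycle_involutive hA).
    by rewrite conj1g; exact: parabolic1.
  rewrite conjMg; apply: parabolicM => //; apply: parabolic_gen.
  by apply: ascent_conj => //; exact: Ay.
have sxS : parabolic S (star x) by apply/(parabolic_star hN hs).
apply: (lmin_uniq hN JS xS sxS xJm (u := z0^-1 * y ^ x^-1)).
- by rewrite (lmin_star hN hs hS).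
- by apply: parabolicM; [exact/parabolicV|exact: AJ].
- by rewrite -mulgA -conjgCV -zxE mulKg.
Qed.

(** Each s in A is a right descent of y, hence of x * y. For any other s, one of s and star s is a
    right descent of x, hence s is because star x = x, and lengths add in z0 * x. *)
Lemma extremal_longest : S `<=` N (z0 * star x)^-1.
Proof.
have [_ _ /fsubsetP Ay] := yD.
have yVA : parabolic A y^-1 by exact/parabolicV.
have xVS : parabolic S x^-1 by exact/parabolicV.
apply/fsubsetP => s sS; case: (boolP (s \in A)) => sA.
  rewrite zxE invgM; apply: (fsubsetP (lmin_sub hN AS xVS xm yVA)).
  rewrite -yst -[s]hs (cocycle_star hN hs hS); last exact: parabolicS yA.
  by apply: Ay; rewrite (star_stableP hs _ (asc_stable x)).
have sx : s \in N x^-1.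
  move: sA; rewrite in_asc sS /= negb_and !negbK => /orP[//|].
  by rewrite -(cocycle_star hN hs hS) // hs multiplicativeV xst.
rewrite xst invgM; apply: (fsubsetP (len_add_sub hN _)) sx.
by rewrite -invgM !(lenV hN) (lmin_add hN JS xS xJm zJ) addnC.
Qed.

End Extremum.

Section LongestElement.
Variable w0 : W.
Hypotheses (w0S : parabolic S w0) (Sw0 : S `<=` N w0).

Lemma longest_star : star w0 = w0.
Proof.
apply: (longest_uniq hN Sw0) => //; last exact/(parabolic_star hN hs).
apply/fsubsetP => s sS; rewrite -[s]hs (cocycle_star hN hs hS) //.
by apply: (fsubsetP Sw0); rewrite (star_stableP hs _ hS).
Qed.

Let w0V : w0^-1 = w0 := longestV hN Sw0 w0S.
Let w0K : w0 * w0 = 1. Proof. by rewrite -{1}w0V mulVg. Qed.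

Lemma len_longestJ u : parabolic S u -> len (u ^ w0) = len u.
Proof.
move=> uS; have uVS : parabolic S u^-1 by exact/parabolicV.
have uwS : parabolic S (u * w0) by exact: parabolicM.
have := longest_add hN Sw0 w0S uwS; have := longest_add hN Sw0 w0S uVS.
rewrite invgK (lenV hN) invgM w0V.
have -> : w0 * u^-1 * w0 = (u ^ w0)^-1 by rewrite conjgE !invgM invgK w0V.
rewrite (lenV hN).
by move: (len _) (len _) (len _) (len _) => a b c d; lia.
Qed.

Lemma longestJ_gen s : (s ^ w0 \in S) = (s \in S).
Proof.
have sub r : r \in S -> r ^ w0 \in S.
  move=> rS; apply: (parabolic_unit_len hN (fsubset_refl S)).
    rewrite conjgE; apply/parabolicMl; first exact/parabolicV.
    by apply: parabolicM => //; exact: parabolic_gen.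
  by rewrite len_longestJ ?(cocycle_gen hN) ?cardfs1 //; exact: parabolic_gen.
by apply/idP/idP => /sub //; rewrite -conjgM w0K conjg1.
Qed.

(** [N w0] contains every conjugate of a generator: when t ^ s differs from s, it lies in
    [N (s * w0)], which is contained in [N w0] by maximality. *)
Lemma longest_conj t u : t \in N w0 -> parabolic S u -> t ^ u \in N w0.
Proof.
move=> tw uS; move: u uS t tw; apply: parabolic_ind => [s|t|s u sS _ IHu t tw].
- exact: (cocycle_involutive hN).
- by rewrite conjg1.
rewrite conjgM; apply: IHu.
have swS : parabolic S (s * w0) by apply: parabolicM => //; exact: parabolic_gen.
have [->|ne] := eqVneq (t ^ s) s; first exact: (fsubsetP Sw0).
apply: (fsubsetP (longest_sub hN Sw0 w0S swS)).
rewrite (cocycleM hN) (cocycle_gen hN sS) inE (negbTE ne) /=.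
by rewrite -conjgM (cocycle_involutive hN sS) conjg1.
Qed.

(** Since z0 is an involution, y = z0 ^ w0, and A is the conjugate of J by w0. Each element of A is
    a descent of y, and descents of an element of W_I lie in I. *)
Lemma extremal_exists z0 : parabolic S z0 -> star z0 = z0^-1 ->
    (forall s, s \in S -> s \in N z0 -> s * z0 = z0 * star s) ->
  let x := z0 * w0 in let A := asc x in let y := x^-1 * z0 * star x in
  parabolic A y /\ (forall a, a \in A -> ~ parabolic (A `\` [fset a; star a]) y).
Proof.
move=> zS zst zcomm x A y.
have [zJ Jst Jcomm] := twisted_descents hN hs hS zS zst zcomm.
set J := S `&` N z0 in zJ Jst Jcomm.
have JS : J `<=` S by exact: fsubsetIl.
have z2 : z0 * z0 = 1 by rewrite Jcomm // zst mulgV.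
have zV : z0^-1 = z0 by rewrite -[LHS]mulg1 -z2 mulKg.
have yE : y = z0 ^ w0.
  by rewrite /y /x gmulfM longest_star zst zV invgM zV conjgE w0V -!mulgA [z0 * (z0 *
    _)]mulgA z2 mul1g.
have inA a : (a \in A) = (a ^ w0 \in J).
  have wall b : b \in S -> (b \notin N x^-1) = (b ^ w0 \in J).
    move=> bS; rewrite /x invgM zV w0V (cocycleM hN) (fsubsetP Sw0 _ bS) /= negbK.
    by rewrite inE longestJ_gen bS.
  rewrite in_asc; case: (boolP (a \in S)) => [aS|aS] /=; last first.
    by rewrite inE longestJ_gen (negbTE aS).
  rewrite !wall ?(star_stableP hs _ hS) //.
  by rewrite -{2}longest_star -multiplicativeJ (star_stableP hs _ Jst) andbb.
split.
  suff sub w : parabolic J w -> parabolic A (w ^ w0) by rewrite yE; exact: sub.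
  move: w; apply: parabolic_ind => [s /(fsubsetP JS)||s w sJ _ h].
  - exact: (cocycle_involutive hN).
  - by rewrite conj1g; exact: parabolic1.
  rewrite conjMg; apply: parabolicM => //; apply: parabolic_gen.
  by rewrite inA -conjgM w0K conjg1.
move=> a aA h.
have AS : A `\` [fset a; star a] `<=` S := fsubset_trans (fsubsetDl _ _) (asc_sub x).
have aS : a \in S := fsubsetP (asc_sub x) _ aA.
suff ay : a \in N y.
  by have := descent_parabolic hN AS aS ay h; rewrite !inE eqxx.
have := aA; rewrite inA inE => /andP[bS bz].
rewrite (len_ltP hN y aS).
have -> : a * y = (a ^ w0 * z0) ^ w0.
  by rewrite yE conjMg -[(a ^ w0) ^ w0]conjgM w0K conjg1.
rewrite yE !len_longestJ // ?(len_descent hN bS bz) //.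
by apply: parabolicM => //; exact: parabolic_gen.
Qed.

(** [N (v * z0 * w0)] is the complement of [N (v * z0)] in [N w0], and [N (v * z0)] is contained in
    [N z]; the walls counted are therefore those of w0 that are not walls of z. *)
Lemma extremal_weight z v : parabolic S z -> star z = z^-1 -> parabolic S v ->
    let z0 := v^-1 * z * star v in len z = (2 * len v + len z0)%N ->
  (len z + 2 * #|` N (v * (z0 * w0)) `\` N z| = 2 * len w0 - len z)%N.
Proof.
move=> zS zst vS z0 lz.
have z0S : parabolic S z0 by exact: (parabolic_twist hN hs hS).
have /fsubsetP sub : N (v * z0) `<=` N z.
  have zE : z = v * z0 * (star v)^-1 by rewrite /z0 !mulgA mulgV mul1g mulgK.
  rewrite [in X in _ `<=` X]zE; apply: (len_add_sub hN).
  rewrite -zE lz (lenV hN) (len_star hN hs hS vS) mul2n -addnn addnAC leq_add2r.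
  exact: (len_le hN).
have zw : N z `<=` N w0 by exact: (longest_sub hN).
have -> : N (v * (z0 * w0)) `\` N z = N w0 `\` N z.
  apply/fsetP => t; rewrite !inE; case: (boolP (t \in N z)) => //= tz.
  have vwS : parabolic S (v * (z0 * w0)) by apply: parabolicM => //; exact: parabolicM.
  apply/idP/idP => [|tw]; first exact: (fsubsetP (longest_sub hN Sw0 w0S vwS)).
  rewrite mulgA (cocycleM hN) longest_conj //; last exact: parabolicM.
  by rewrite addbT; apply: contra tz; exact: sub.
rewrite cardfsDS //; have := fsubset_leq_card zw.
by move: (len _) (len _) => a b; lia.
Qed.

End LongestElement.

End Extremal.

(** * Signed sums over star-stable subsets *)

Section Sums.
Variable R : zmodType.
Local Open Scope ring_scope.

Lemma sum_reindex (T U : choiceType) (A : {fset T}) (P : pred T) (B : {fset U})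
    (Q : pred U) (f : T -> U) (g : U -> T) (F : U -> R) :
    (forall x, x \in A -> P x -> [/\ f x \in B, Q (f x) & g (f x) = x]) ->
    (forall y, y \in B -> Q y -> [/\ g y \in A, P (g y) & f (g y) = y]) ->
  \sum_(x <- A | P x) F (f x) = \sum_(y <- B | Q y) F y.
Proof.
move=> hf hg; rewrite -big_filter -(big_filter B) -(big_map f predT).
apply: perm_big; apply: uniq_perm.
- rewrite map_inj_in_uniq ?filter_uniq ?fset_uniq // => x y.
  rewrite !mem_filter => /andP[Px xA] /andP[Py yA] e.
  by have [_ _ <-] := hf x xA Px; have [_ _ <-] := hf y yA Py; rewrite e.
- by rewrite filter_uniq ?fset_uniq.
move=> y; rewrite mem_filter; apply/mapP/andP => [[x]|[Qy yB]].
  by rewrite mem_filter => /andP[Px xA] ->; have [? ? _] := hf x xA Px.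
by have [gA Pg <-] := hg y yB Qy; exists (g y); rewrite // mem_filter Pg.
Qed.

Lemma sum_single (T : choiceType) (A : {fset T}) x (F : T -> R) :
  x \in A -> (forall y, y \in A -> y != x -> F y = 0) -> \sum_(y <- A) F y = F x.
Proof.
move=> xA h; rewrite (big_fsetD1 x) //= big_seq big1 ?addr0 // => y.
by rewrite !inE => /andP[yx yA]; exact: h.
Qed.

End Sums.

Section Orbits.
Variables (W : groupType) (star : {multiplicative W -> W}).
Hypothesis hs : involutive star.
Implicit Types (A B I : {fset W}) (s : W).

Local Notation r := (star_orbits star).

Lemma star_orbits0 : r fset0 = 0%N.
Proof. by rewrite /star_orbits imfset0 cardfs0. Qed.

Lemma star_orbits_pair s : r [fset s; star s] = 1%N.
Proof.
rewrite /star_orbits imfset_fset2 hs.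
have -> : [fset star s; s] = [fset s; star s] by exact: fsetUC.
by rewrite fsetUid cardfs1.
Qed.

Lemma star_stableU A B : star_stable star A -> star_stable star B ->
  star_stable star (A `|` B).
Proof. by rewrite /star_stable imfsetU => /eqP -> /eqP ->. Qed.

Lemma star_stableD A B : star_stable star A -> star_stable star B ->
  star_stable star (A `\` B).
Proof.
move=> /(star_stableP hs) hA /(star_stableP hs) hB; apply/(star_stableP hs) => s.
by rewrite !inE hA hB.
Qed.

Lemma star_stable_pair s : star_stable star [fset s; star s].
Proof. by apply/(star_stableP hs) => t;
  rewrite !inE (inv_eq hs) (inj_eq (inv_inj hs)) orbC. Qed.

Lemma star_stable0 : star_stable star fset0.
Proof. by apply/(star_stableP hs) => t; rewrite !inE. Qed.

Lemma star_orbitsU A B : star_stable star B ->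
  [disjoint A & B] -> r (A `|` B) = (r A + r B)%N.
Proof.
move=> /(star_stableP hs) hB /eqP dAB; rewrite /star_orbits imfsetU cardfsU.
set X := _ `&` _; suff -> : X = fset0 by rewrite cardfs0 subn0.
apply/fsetP => o; rewrite !inE; apply/negP => /andP[/imfsetP[s /= sA ->]].
move=> /imfsetP[t /= tB] /fsetP/(_ s); rewrite !inE eqxx /= => /esym /orP h.
have sB : s \in B by case: h => /eqP ->; rewrite ?hB.
by move/fsetP/(_ s): dAB; rewrite !inE sA sB.
Qed.

Lemma star_orbitsD A B : star_stable star A -> star_stable star B -> B `<=` A ->
  r A = (r (A `\` B) + r B)%N.
Proof.
move=> sA sB BA; rewrite -star_orbitsU ?star_stableD //.
  by rewrite fsetUC fsetUDl fsetDv fsetD0; congr r; apply/esym/fsetUidPr.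
by rewrite -fsetI_eq0; apply/eqP/fsetP => x; rewrite !inE; case: (x \in B);
  rewrite ?andbF.
Qed.

Variable R : comNzRingType.

(** Sign-reversing involution: adding or removing the orbit of s preserves [Q] and changes the
    number of orbits by one. *)
Lemma toggle_sum0 S (Q : pred {fset W}) s : star_stable star S -> s \in S ->
    (forall I, star_stable star I -> I `<=` S ->
       Q (I `|` [fset s; star s]) = Q (I `\` [fset s; star s])) ->
  (\sum_(I <- fpowerset S | star_stable star I && Q I) (-1) ^+ r I = 0 :> R)%R.
Proof.
move=> Sst sS hQ; set o := [fset s; star s] in hQ.
have ost : star_stable star o := star_stable_pair s.
have so : s \in o by rewrite !inE eqxx.
have oS : o `<=` S by apply/fsubsetP => t; rewrite !inE => /orP[]/eqP ->;
  rewrite ?(star_stableP hs _ Sst).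
have oI I : star_stable star I -> s \in I -> o `<=` I.
  by move=> Ist sI; apply/fsubsetP => t; rewrite !inE => /orP[]/eqP ->;
    rewrite ?(star_stableP hs _ Ist).
have oNI I : star_stable star I -> s \notin I -> [disjoint I & o].
  move=> Ist sI; apply/fdisjointP => t tI; apply/negP; rewrite !inE => /orP[]/eqP e.
    by rewrite -e tI in sI.
  by rewrite -(star_stableP hs _ Ist) -e tI in sI.
rewrite (bigID (fun I => s \in I)) /=.
rewrite -(@sum_reindex _ _ _ (fpowerset S)
  (fun I => (star_stable star I && Q I) && (s \notin I)) _ _
  (fun I => I `|` o) (fun I => I `\` o)); last first.
- move=> I; rewrite fpowersetE => IS /andP[/andP[Ist QI] sI].
  have e : I `\` o `|` o = I.
    by rewrite fsetUC fsetUDl fsetDv fsetD0; apply/fsetUidPr/oI.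
  split=> //; first by rewrite fpowersetE (fsubset_trans (fsubsetDl _ _)).
  rewrite star_stableD //= !inE eqxx /= andbT -hQ //.
  by have /fsetUidPl -> := oI _ Ist sI.
- move=> I; rewrite fpowersetE => IS /andP[/andP[Ist QI] sI].
  have e : I `\` o = I by apply/fsetDidPl/oNI.
  split; first by rewrite fpowersetE fsubUset IS.
    by rewrite star_stableU //= hQ // e QI !inE eqxx orbT.
  by rewrite fsetDUl fsetDv fsetU0.
rewrite -big_split /= big1 // => I /andP[/andP[Ist _] sI].
by rewrite star_orbitsU ?oNI // star_orbits_pair addn1 exprS mulN1r addNr.
Qed.

End Orbits.

Section SignedSum.
Variables (W : groupType) (S : {fset W}) (N : W -> {fset W}).
Hypothesis hN : inversion_cocycle S N.
Variable star : {multiplicative W -> W}.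
Hypothesis hs : involutive star.
Hypothesis hS : star_stable star S.
Implicit Types (I J A : {fset W}) (w v s t x y u z d a b : W).

Local Notation len w := (#|` N w%g|).
Local Notation r := (star_orbits star).
Local Notation asc x := (star_ascents N star S x).

(** For [A] = [asc x] and y = x^-1 * z * star x, this is the signed count of the cosets x W_I, with
    x shortest, that are fixed by w |-> z * star w. *)
Definition signed_sum A y : rat :=
  (\sum_(I <- fpowerset S | star_stable star I && ((I `<=` A) && `[< parabolic I y >]))
     (-1) ^+ r I)%R.

(** As W_I and W_K intersect in the parabolic subgroup of the intersection of I and K, adding or
    removing the orbit of a does not affect whether y is in W_I. *)
Lemma signed_sum0 A y a : star_stable star A -> A `<=` S -> a \in A ->
  parabolic (A `\` [fset a; star a]) y -> signed_sum A y = 0%R.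
Proof.
move=> Ast AS aA yA.
apply: (@toggle_sum0 _ _ hs _ _ (fun I => (I `<=` A) && `[< parabolic I y >]) _ hS
  (fsubsetP AS a aA)) => I Ist IS.
set o := [fset a; star a] in yA *.
have oA : o `<=` A.
  by apply/fsubsetP => t; rewrite !inE => /orP[]/eqP ->; rewrite ?(star_stableP hs _ Ast).
have e1 : (I `|` o `<=` A) = (I `\` o `<=` A) by rewrite fsubUset oA andbT fsubDset
  (fsetUidPr _ _ oA).
rewrite e1; case: (boolP (_ `<=` _)) => //= IA; apply/asbool_equiv_eq; split.
  move=> h; have IoS : I `|` o `<=` S by rewrite fsubUset IS (fsubset_trans oA).
  have := parabolicI hN IoS (fsubset_trans (fsubsetDl A o) AS) h yA.
  apply: parabolicS; apply/fsubsetP => t.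
  rewrite in_fsetI in_fsetU !in_fsetD; case: (t \in o); rewrite ?andbF //= orbF.
  by case/andP.
apply: parabolicS; apply: fsubset_trans (fsubsetUl _ _); exact: fsubsetDl.
Qed.

(** Full support leaves only the term I = A. *)
Lemma signed_sum_sign A y : star_stable star A -> A `<=` S -> parabolic A y ->
    (forall a, a \in A -> ~ parabolic (A `\` [fset a; star a]) y) ->
  signed_sum A y = ((-1) ^+ r A)%R.
Proof.
move=> Ast AS yA h; rewrite /signed_sum big_mkcond (sum_single (x := A)).
- by rewrite Ast fsubset_refl; case: asboolP.
- by rewrite fpowersetE.
move=> I; rewrite fpowersetE => IS IA; case: ifP => // /and3P[Ist IAs /asboolP yI].
have /fsubsetPn[a aA aI] : ~~ (A `<=` I) by apply: contra IA => AI;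
  rewrite eqEfsubset IAs.
case: (h a aA); apply: parabolicS yI; apply/fsubsetP => t tI.
rewrite in_fsetD (fsubsetP IAs) // andbT !inE; apply/negP => /orP[]/eqP e.
  by rewrite -e tI in aI.
by rewrite -(star_stableP hs _ Ist) -e tI in aI.
Qed.

Lemma signed_sum_nz A y : star_stable star A -> A `<=` S -> signed_sum A y <> 0%R ->
  parabolic A y /\ (forall a, a \in A -> ~ parabolic (A `\` [fset a; star a]) y).
Proof.
move=> Ast AS nz; split; last first.
  by move=> a aA h; apply: nz; exact: (signed_sum0 Ast AS aA h).
apply: contrapT => h; apply: nz;
  rewrite /signed_sum big1 // => I /and3P[_ IA /asboolP yI].
by case: h; exact: parabolicS yI.
Qed.

(** * The twisted form of Solomon's formula for the sign character *)

Section Parity.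
Variable w0 : W.
Hypotheses (w0S : parabolic S w0) (Sw0 : S `<=` N w0).
Hypothesis w0comm : {in S, forall s, s * w0 = w0 * star s}.
Hypothesis finS : finite_set (parabolic S).

Let G I := fset_set (parabolic I).

Let inG I x : I `<=` S -> (x \in G I) = `[< parabolic I x >].
Proof.
move=> IS; rewrite in_fset_set; last exact: (sub_finite_set (parabolicS IS)).
by apply/idP/asboolP; rewrite inE.
Qed.

Let GP I x : I `<=` S -> reflect (parabolic I x) (x \in G I).
Proof. by move=> IS; rewrite inG //; apply: asboolP. Qed.

Let GS x : reflect (parabolic S x) (x \in G S).
Proof. exact: GP. Qed.

(** Minimality gives inclusions between [N d'] and the conjugate of [N d] by a in both directions,
    hence equality. A right descent s of a then satisfies s ^ d in W_I, so it can be moved from a to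
    b, and the induction on the length of a ends in a single coset of W_I. *)
Lemma double_min_uniq I J d d' a b : I `<=` S -> J `<=` S ->
    parabolic S d -> parabolic S d' -> lmin N J d -> lmin N J d' ->
    lmin N I d^-1 -> lmin N I d'^-1 -> parabolic J a -> parabolic I b ->
  d' = a * d * b -> d' = d.
Proof.
move=> IS JS dS d'S dJ d'J dI d'I aJ bI.
have le e e' c f : parabolic S e -> lmin N J e -> parabolic J c -> parabolic I f ->
    lmin N I e^-1 -> e' = c * e * f -> conjf c (N e) `<=` N e'.
  move=> eS eJ cJ fI eI ->; apply/fsubsetP => t; rewrite in_conjf => te.
  rewrite -mulgA (cocycleM hN) (cocycleM hN) te.
  have -> : t \in N c = false.
    apply/negP => tc; have tJ := cocycle_parabolic (sub_cocycle hN JS) cJ tc.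
    have tcJ : parabolic J (t ^ c).
      rewrite conjgE; apply/parabolicMl; first exact/parabolicV.
      exact: parabolicM.
    by have := lmin_parabolic hN JS eS eJ tcJ; rewrite te.
  rewrite /=; apply/negP => tf.
  have := rmin_parabolic hN IS eS eI (cocycle_parabolic (sub_cocycle hN IS) fI tf).
  by rewrite te.
have [n] := ubnP (len a); elim: n a aJ b bI => // n IHn a aJ b bI la e.
have dE : d = a^-1 * d' * b^-1 by rewrite e !mulgA mulVg mul1g mulgK.
have aVJ : parabolic J a^-1 by exact/parabolicV.
have bVI : parabolic I b^-1 by exact/parabolicV.
have s1 := le _ _ _ _ dS dJ aJ bI dI e.
have s2 := le _ _ _ _ d'S d'J aVJ bVI d'I dE.
have Nd' : conjf a (N d) = N d'.
  apply/eqP; rewrite eqEfcard s1 card_conjf.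
  by have := fsubset_leq_card s2; rewrite card_conjf.
have [a1|/eqP a1] := eqVneq a 1.
  apply: (rmin_uniq hN IS dS d'S dI d'I bI); by rewrite e a1 mul1g.
have a1' : a^-1 <> 1 by move=> h; apply: a1; rewrite -(invgK a) h invg1.
have hJ := sub_cocycle hN JS.
have [s sJ sa] := exists_descent hJ aVJ a1'.
have sdb : s \in N (d * b).
  have : s ^ a^-1 \notin N d' by rewrite -Nd' in_conjf conjgKV; exact: (allP dJ).
  by rewrite e -mulgA (cocycleM hN a) conjgKV -(cocycleV hN) sa /= negbK.
have tI : parabolic I (s ^ d).
  apply: (cocycle_parabolic (sub_cocycle hN IS) bI).
  by move: sdb; rewrite (cocycleM hN) (negbTE (allP dJ _ sJ)).
apply: (IHn (a * s) _ (s ^ d * b)).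
- by apply: parabolicM => //; exact: parabolic_gen.
- exact: parabolicM.
- have := len_descent hJ sJ sa; rewrite -{1}(cocycle_genV hJ sJ) -invgM !(lenV hN) => h.
  by move: la; rewrite h.
- by rewrite e conjgE !mulgA mulgK -[a * s * s]mulgA (cocycle_involutive hJ sJ) mulg1.
Qed.

Lemma double_min_exists I J x : I `<=` S -> J `<=` S -> parabolic S x ->
  exists a d b, [/\ parabolic J a, parabolic S d, parabolic I b, x = a * d * b
    & lmin N J d /\ lmin N I d^-1].
Proof.
move=> IS JS xS.
have [|d [[a [b [aJ bI xE]] dmin]]] := @exists_argmin _ (fun d => exists a b,
    [/\ parabolic J a, parabolic I b & x = a * d * b]) (fun d => len d).
  exists x, 1, 1; rewrite mulg1 mul1g; split=> //; exact: parabolic1.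
have dE : d = a^-1 * x * b^-1 by rewrite xE !mulgA mulVg mul1g mulgK.
have dS : parabolic S d.
  rewrite dE; apply: parabolicM; last by apply: (parabolicS IS); exact/parabolicV.
  by apply: parabolicM => //; apply: (parabolicS JS); exact/parabolicV.
have dVS : parabolic S d^-1 by exact/parabolicV.
exists a, d, b; split=> //; split; apply/allP => s sX; apply/negP => sd.
  have sS := fsubsetP JS _ sX.
  have h : exists a' b', [/\ parabolic J a', parabolic I b' & x = a' * (s * d) * b'].
    exists (a * s), b; split=> //; first by apply: parabolicM => //; exact: parabolic_gen.
    by rewrite xE -!mulgA (cocycle_genK hN) // !mulgA.
  by have := dmin _ h; rewrite (len_descent hN sS sd) ltnn.
have sS := fsubsetP IS _ sX.
have h : exists a' b', [/\ parabolic J a', parabolic I b' & x = a' * (d * s) * b'].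
  exists a, (s * b); split=> //; first by apply: parabolicM => //; exact: parabolic_gen.
  by rewrite xE -!mulgA (cocycle_genK hN).
have := dmin _ h; rewrite -(lenV hN d) (len_descent hN sS sd).
by rewrite -{1}(cocycle_genV hN sS) -invgM (lenV hN) ltnn.
Qed.

Local Open Scope ring_scope.

Let n I : rat := \sum_(x <- G S) (x \in G I)%:R.
(** For star-stable I this counts elements, not cosets: it is [n I] times the number of cosets x W_I
    fixed by w |-> z * star w, which explains the division by [n I] in [e]. *)
Let fixed I z : rat := \sum_(x <- G S) ((x^-1 * z * star x)%g \in G I)%:R.
Let dmin I J d := [&& star d == d, lmin N J d & lmin N I d^-1].

Let sum_mulL (F : W -> rat) a : parabolic S a ->
  \sum_(x <- G S) F (a * x)%g = \sum_(x <- G S) F x.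
Proof.
move=> aS; apply: (sum_reindex (g := fun x => (a^-1 * x)%g)) => x /GS xS _.
  by split; rewrite ?mulKg //; apply/GS; exact: parabolicM.
by split; rewrite ?mulVKg //; apply/GS; apply: parabolicM => //; exact/parabolicV.
Qed.

Let sum_mulR (F : W -> rat) a : parabolic S a ->
  \sum_(x <- G S) F (x * a)%g = \sum_(x <- G S) F x.
Proof.
move=> aS; apply: (sum_reindex (g := fun x => (x * a^-1)%g)) => x /GS xS _.
  by split; rewrite ?mulgK //; apply/GS; exact: parabolicM.
by split; rewrite ?mulgVK //; apply/GS; apply: parabolicM => //; exact/parabolicV.
Qed.

(** Write x = a0 * d * b0 with d shortest in W_J x W_I. Only this d can contribute on the right.
    Both sides vanish unless star d = d, since otherwise no v maps the double coset to itself; if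
    star d = d, the substitution a = v * star a0 matches the two counts. *)
Let star_fixed_cosets I J x : star_stable star I -> star_stable star J ->
    I `<=` S -> J `<=` S -> parabolic S x ->
  \sum_(v <- G S) (v \in G J)%:R * ((x^-1 * v * star x)%g \in G I)%:R =
  \sum_(d <- G S) (dmin I J d)%:R *
     (\sum_(a <- G S) (a \in G J)%:R * ((d^-1 * a^-1 * x)%g \in G I)%:R) :> rat.
Proof.
move=> Ist Jst IS JS xS.
have [a0 [d [b0 [a0J dS b0I xE [dJ dI]]]]] := double_min_exists IS JS xS.
have xE' : star x = (star a0 * star d * star b0)%g by rewrite xE !gmulfM.
have sa0J : parabolic J (star a0) by exact/(parabolic_star hN hs).
have sb0I : parabolic I (star b0) by exact/(parabolic_star hN hs).
have sdS : parabolic S (star d) by exact/(parabolic_star hN hs).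
rewrite [RHS](sum_single (x := d)); first last.
- move=> d' /GS d'S ne /=; have [/and3P[_ d'J d'I]|_] := boolP (dmin I J d');
  last by rewrite mul0r.
  rewrite mul1r big1_seq // => a /= _; case: GP => // aJ; last by rewrite mul0r.
  case: GP => // bI.
  case/eqP: ne; apply: (double_min_uniq IS JS dS d'S dJ d'J dI d'I
     (a := (a^-1 * a0)%g) (b := (b0 * (d'^-1 * a^-1 * x)^-1)%g)).
  + by apply: parabolicM => //; exact/parabolicV.
  + by apply: parabolicM => //; exact/parabolicV.
  + by rewrite xE !invgM !invgK !mulgA !(mulgK, mulgVK) mulVg mul1g.
- exact/GS.
have [sd|sd] := eqVneq (star d) d; last first.
  have -> : dmin I J d = false by rewrite /dmin (negbTE sd).
  rewrite mul0r big1_seq // => v /= _; case: GP => // vJ; last by rewrite mul0r.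
  case: GP => // uI.
  case/eqP: sd; set u := (x^-1 * v * star x)%g in uI.
  apply: (double_min_uniq IS JS dS sdS dJ _ dI _ (a := ((v * star a0)^-1 * a0)%g)
            (b := (b0 * u * (star b0)^-1)%g)).
  + by rewrite (lmin_star hN hs hS).
  + by rewrite -multiplicativeV (lmin_star hN hs hS) //; exact/parabolicV.
  + by apply: parabolicM => //; apply/parabolicV; exact: parabolicM.
  + by apply: parabolicM; [exact: parabolicM|exact/parabolicV].
  + have -> : star d = ((star a0)^-1 * star x * (star b0)^-1)%g.
      by rewrite xE' !mulgA mulVg mul1g mulgK.
    rewrite /u xE' xE !invgM !mulgA !(mulgK, mulgVK).
    by rewrite -!mulgA !(mulKg, mulVKg).
have -> : dmin I J d by rewrite /dmin sd eqxx dJ.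
rewrite mul1r -[RHS](sum_mulR _ (parabolicS JS sa0J)); apply: eq_bigr => v _.
congr ((nat_of_bool _)%:R * (nat_of_bool _)%:R).
  by rewrite !inG //; apply/asbool_equiv_eq; split => [h|/parabolicMr];
    [exact: parabolicM|apply].
rewrite !inG //; apply/asbool_equiv_eq.
have -> : (d^-1 * (v * star a0)^-1 * x = star b0 * (x^-1 * v * star x)^-1)%g.
  rewrite xE' sd !invgM !invgK !mulgA.
  by rewrite mulgV mul1g.
split=> [h|/parabolicMl h]; first by apply: parabolicM => //; exact/parabolicV.
by apply/parabolicV; exact: h.
Qed.

Let nG : rat := \sum_(x <- G S) 1.

(** Twisted conjugation of z by y removes y from the summand, which gives the factor [nG]. The
    remaining sum is evaluated one star-fixed double coset representative d at a time, each
    contributing [n I * n J]. *)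
Let fixed_prod I J : star_stable star I -> star_stable star J -> I `<=` S -> J `<=` S ->
  \sum_(z <- G S) fixed I z * fixed J z =
  nG * (n I * n J * \sum_(d <- G S) (dmin I J d)%:R).
Proof.
move=> Ist Jst IS JS.
transitivity (\sum_(y <- G S) \sum_(x <- G S) \sum_(v <- G S)
    (v \in G J)%:R * ((x^-1 * v * star x)%g \in G I)%:R : rat).
  transitivity (\sum_(z <- G S) \sum_(y <- G S) \sum_(x <- G S)
      ((y^-1 * z * star y)%g \in G J)%:R * ((x^-1 * z * star x)%g \in G I)%:R : rat).
    apply: eq_bigr => z _; rewrite mulrC big_distrl; apply: eq_bigr => y _.
    by rewrite big_distrr.
  rewrite exchange_big; apply: eq_big_seq => y /GS yS.
  have syS : parabolic S (star y)^-1%g by apply/parabolicV/(parabolic_star hN hs).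
  rewrite -(sum_mulL _ yS) -(sum_mulR _ syS) [RHS]exchange_big; apply: eq_bigr => v _.
  rewrite -(sum_mulL _ yS); apply: eq_bigr => x _;
    congr ((nat_of_bool _)%:R * (nat_of_bool _)%:R).
    by rewrite !mulgA mulVg mul1g mulgVK.
  by rewrite gmulfM invgM -!mulgA !(mulKg, mulVKg).
transitivity (\sum_(y <- G S) \sum_(d <- G S) (dmin I J d)%:R * (n I * n J)).
  apply: eq_bigr => y _.
  transitivity (\sum_(x <- G S) \sum_(d <- G S) (dmin I J d)%:R *
     (\sum_(a <- G S) (a \in G J)%:R * ((d^-1 * a^-1 * x)%g \in G I)%:R) : rat).
    by apply: eq_big_seq => x /GS xS; exact: star_fixed_cosets.
  rewrite exchange_big; apply: eq_big_seq => d /GS dS.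
  rewrite -big_distrr exchange_big; congr (_ * _).
  rewrite /n mulrC big_distrl; apply: eq_big_seq => a /GS aS.
  rewrite -big_distrr; congr (_ * _); rewrite /=.
  rewrite -(sum_mulL _ (parabolicM aS dS)); apply: eq_bigr => x _.
  by rewrite -!mulgA !mulKg.
by rewrite [RHS]big_distrl /=; apply: eq_bigr => y _;
  rewrite [RHS]mul1r [RHS]mulrC [RHS]big_distrl.
Qed.

Let nIn0 I : I `<=` S -> n I != 0.
Proof.
move=> IS; rewrite gt_eqF // /n (big_fsetD1 1%g) /=; last by apply/GS; exact: parabolic1.
have -> : 1%g \in G I by apply/(GP _ IS); exact: parabolic1.
by rewrite ltr_wpDr //; apply: sumr_ge0 => x _; case: (_ \in _).
Qed.

Let sgn z : rat := (-1) ^+ len z.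

Let sgnM x y : sgn (x * y)%g = sgn x * sgn y.
Proof. by rewrite /sgn -!(signr_odd _ (len _)) (len_odd hN) signr_addb. Qed.

Let e z : rat := \sum_(I <- fpowerset S | star_stable star I) (-1) ^+ r I / n I *
  fixed I z.

(** Twisted conjugation preserves the sign. If I contains some s, multiplication by s turns the
    signed sum over W_I into its negative, so only I = fset0 contributes. *)
Let e_sgn : \sum_(z <- G S) e z * sgn z = nG.
Proof.
transitivity (\sum_(I <- fpowerset S | star_stable star I)
    (-1) ^+ r I / n I * (\sum_(z <- G S) fixed I z * sgn z)).
  under eq_bigr do rewrite big_distrl; rewrite exchange_big /=.
  by apply: eq_bigr => I _; rewrite [RHS]big_distrr; apply: eq_bigr => z _;
    rewrite /= mulrA.
transitivity (\sum_(I <- fpowerset S | star_stable star I)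
    (-1) ^+ r I / n I * (nG * (\sum_(u <- G S) (u \in G I)%:R * sgn u))).
  apply: eq_bigr => I _; congr (_ * _); rewrite /nG big_distrl /=.
  under eq_bigr do rewrite big_distrl; rewrite exchange_big;
    apply: eq_big_seq => x /GS xS.
  have sxS : parabolic S (star x)^-1%g by apply/parabolicV/(parabolic_star hN hs).
  rewrite mul1r -(sum_mulL _ xS) -(sum_mulR _ sxS); apply: eq_bigr => u _.
  congr ((nat_of_bool _)%:R * _); first by rewrite !mulgA mulVg mul1g mulgVK.
  rewrite !sgnM mulrCA [sgn _^-1]/sgn (lenV hN) (len_star hN hs hS) // -/(sgn x).
  by rewrite -expr2 sqrr_sign mulr1.
rewrite big_mkcond (sum_single (x := fset0)) /=; last 2 first.
- by rewrite fpowersetE fsub0set.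
- move=> I; rewrite fpowersetE => IS /fset0Pn[s sI]; case: ifP => // _.
  have sP := parabolic_gen sI; have sS := fsubsetP IS _ sI.
  set X := \sum_(u <- _) _; suff /eqP : X = - X.
    by rewrite -addr_eq0 -mulr2n mulrn_eq0 /= => /eqP ->; rewrite !mulr0.
  rewrite {1}/X -(sum_mulL _ (parabolic_gen sS)) -sumrN; apply: eq_bigr => u _.
  rewrite sgnM [sgn s]/sgn (cocycle_gen hN sS) cardfs1 expr1 mulN1r mulrN;
    congr (- (_%:R * _)).
  congr nat_of_bool; rewrite !inG //; apply/asbool_equiv_eq; exact: parabolicMl.
rewrite star_stable0 // star_orbits0 // expr0.
have G0 u : (u \in G fset0) = (u == 1%g).
  rewrite inG ?fsub0set //; apply/asboolP/eqP => [|->]; last exact: parabolic1.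
  by move: u; apply: parabolic_ind.
have s1 F : \sum_(u <- G S) (u \in G fset0)%:R * F u = F 1%g :> rat.
  rewrite (sum_single (x := 1%g)) /=; last 2 first.
  - by apply/GS; exact: parabolic1.
  - by move=> u _; rewrite G0 => /negbTE ->; rewrite mul0r.
  by rewrite G0 eqxx mul1r.
rewrite s1 /sgn (cocycle1 hN) cardfs0 expr0 mulr1.
have -> : n fset0 = 1 by rewrite -[RHS](s1 (fun=> 1)) /n; apply: eq_bigr => u _;
  rewrite mulr1.
by rewrite invr1 mulr1 mul1r.
Qed.

Let star_w0 : star w0 = w0. Proof. exact: (longest_star hN hs hS). Qed.

Let asc_w0 : asc w0 = fset0.
Proof.
apply/fsetP => s; rewrite in_asc inE (longestV hN Sw0 w0S); apply/negbTE.
by apply/negP => /and3P[/(fsubsetP Sw0) ->].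
Qed.

Let signed_asc d : signed_sum (asc d) 1%g =
  \sum_(I <- fpowerset S | star_stable star I) (-1) ^+ r I * (lmin N I d^-1)%:R.
Proof.
rewrite /signed_sum big_mkcondr big_seq_cond [RHS]big_seq_cond; apply: eq_bigr => I.
rewrite fpowersetE => /andP[IS Ist]; rewrite (lmin_asc N hs d Ist IS).
have -> : `[< parabolic I 1%g >] by apply/asboolP; exact: parabolic1.
by rewrite andbT; case: ifP; rewrite ?mulr1 ?mulr0.
Qed.

(** For each star-fixed d the signs factor into signed sums over the ascents of d and of d^-1. The
    first vanishes unless [asc d] is empty, that is unless d is the longest element. *)
Let e_sq : \sum_(z <- G S) e z * e z = nG.
Proof.
transitivity (\sum_(I <- fpowerset S | star_stable star I) \sum_(J <- fpowerset S |
  star_stable star J)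
   (-1) ^+ r I / n I * ((-1) ^+ r J / n J) * (\sum_(z <- G S) fixed I z * fixed J z)).
  under eq_bigr do rewrite big_distrl; rewrite exchange_big; apply: eq_bigr => I _ /=.
  under eq_bigr do rewrite big_distrr; rewrite exchange_big; apply: eq_bigr => J _ /=.
  by rewrite big_distrr; apply: eq_bigr => z _ /=; rewrite mulrACA.
transitivity (\sum_(I <- fpowerset S | star_stable star I) \sum_(J <- fpowerset S |
  star_stable star J)
   \sum_(d <- G S) nG * ((star d == d)%:R * (((-1) ^+ r I * (lmin N I d^-1)%:R) *
     ((-1) ^+ r J * (lmin N J d)%:R)))).
  rewrite big_seq_cond [RHS]big_seq_cond; apply: eq_bigr => I.
  rewrite fpowersetE => /andP[IS Ist].
  rewrite big_seq_cond [RHS]big_seq_cond; apply: eq_bigr => J.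
  rewrite fpowersetE => /andP[JS Jst].
  rewrite fixed_prod // -big_distrr /=.
  have -> : \sum_(d <- G S) (star d == d)%:R * (((-1) ^+ r I * (lmin N I d^-1)%:R) *
     ((-1) ^+ r J * (lmin N J d)%:R)) =
     (-1) ^+ r I * (-1) ^+ r J * \sum_(d <- G S) (dmin I J d)%:R :> rat.
    rewrite big_distrr; apply: eq_bigr => d _ /=; rewrite /dmin.
    by case: (star d == d); case: (lmin N I d^-1%g); case: (lmin N J d) => /=;
      rewrite ?(mulr0, mul0r, mulr1, mul1r).
  have := nIn0 IS; have := nIn0 JS => nJ0 nI0; field.
  by rewrite nJ0 nI0.
transitivity (\sum_(d <- G S) nG * ((star d == d)%:R * (signed_sum (asc d) 1%g *
  signed_sum (asc d^-1%g) 1%g))).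
  under eq_bigr do rewrite exchange_big; rewrite exchange_big; apply: eq_bigr => d _ /=.
  under eq_bigr do rewrite -big_distrr /= -big_distrr /=.
  rewrite -big_distrr -big_distrr /=; congr (_ * (_ * _)).
  under eq_bigr do rewrite -big_distrr /=.
  by rewrite -big_distrl /= !signed_asc invgK.
rewrite -big_distrr (sum_single (x := w0)) /=; last 2 first.
- exact/GS.
- move=> d /GS dS ne; have [sd|_] := eqVneq (star d) d; last by rewrite mul0r.
  have [d0|/fset0Pn[s sd']] := eqVneq (asc d) fset0; last first.
    by rewrite (signed_sum0 (asc_stable N hs hS d) (asc_sub S N star d) sd') ?mul0r
      ?mulr0 //; exact: parabolic1.
  case/eqP: ne; rewrite -(invgK d) -(longestV hN Sw0 w0S); congr (_^-1)%g.
  apply: (longest_uniq hN Sw0 w0S); last exact/parabolicV.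
  apply/fsubsetP => s sS; move/fsetP/(_ s): d0; rewrite in_asc sS inE /=.
  rewrite -{2}sd -multiplicativeV (cocycle_star hN hs hS); last exact/parabolicV.
  by rewrite andbb => /negbT; rewrite negbK.
rewrite star_w0 eqxx (longestV hN Sw0 w0S) asc_w0.
have -> : signed_sum fset0 1%g = 1.
  rewrite signed_sum_sign ?fsub0set ?star_orbits0 ?expr0 //; first exact: star_stable0.
  exact: parabolic1.
by rewrite !mulr1.
Qed.

(** w0 is invariant under twisted conjugation and lies in W_I only for I = S. *)
Let e_w0 : e w0 = (-1) ^+ r S.
Proof.
have w0c x : parabolic S x -> (x * w0 = w0 * star x)%g.
  move: x; apply: parabolic_ind => [s sS||s u sS _ IH];
    first exact: (cocycle_involutive hN).
    by rewrite multiplicative1 mul1g mulg1.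
  by rewrite gmulfM -mulgA IH !mulgA w0comm.
have fixE I : I `<=` S -> fixed I w0 = nG * (I == S)%:R.
  move=> IS; rewrite /fixed /nG big_distrl; apply: eq_big_seq => x /GS xS /=.
  rewrite mul1r -mulgA -w0c // mulKg; congr (nat_of_bool _)%:R.
  apply/(GP _ IS)/eqP => [w0I|->] //; apply/eqP; rewrite eqEfsubset IS.
  apply/fsubsetP => s sS; apply: (descent_parabolic hN IS sS _ w0I).
  exact: (fsubsetP Sw0).
rewrite /e big_mkcond (sum_single (x := S)) ?fpowersetE //; last first.
  move=> I; rewrite fpowersetE => IS ne; case: ifP => // _.
  by rewrite fixE // (negbTE ne) mulr0 mulr0.
rewrite hS fixE // eqxx mulr1.
have -> : n S = nG by apply: eq_big_seq => x ->.
have : nG != 0; last by move=> nG0; rewrite mulfVK.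
have := nIn0 (fsubset_refl S); suff -> : n S = nG by [].
by apply: eq_big_seq => x ->.
Qed.

(** The squares of e z - sgn z add up to nG - 2 nG + nG = 0, so e and sgn agree at w0. *)
Lemma longest_parity : ((-1) ^+ len w0 = (-1) ^+ r S :> rat).
Proof.
have : \sum_(z <- G S) (e z - sgn z) ^+ 2 = 0.
  transitivity (\sum_(z <- G S) (e z * e z - 2 * (e z * sgn z) + 1)).
    apply: eq_bigr => z _; rewrite sqrrB /sgn sqrr_sign expr2.
    by rewrite mulr_natl.
  rewrite big_split sumrB /= e_sq -big_distrr /= e_sgn -/nG; lra.
move=> /eqP; rewrite psumr_eq0 => [/allP h|z _]; last exact: sqr_ge0.
have := h w0; rewrite sqrf_eq0 subr_eq0 /= => h0.
by rewrite -e_w0; apply/esym/eqP/h0; exact/GS.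
Qed.

End Parity.
End SignedSum.

Lemma sum_pair (R : nmodType) (T U : choiceType) (A : {fset T}) (B : {fset U})
    (F : T -> U -> R) :
  (\sum_(x <- A) \sum_(y <- B) F x y = \sum_(p <- A `*` B) F p.1 p.2)%R.
Proof.
rewrite -(big_allpairs (F := fun p => F p.1 p.2)).
apply: perm_big; apply: uniq_perm => [||[x y]].
- by apply: allpairs_uniq; rewrite ?fset_uniq // => -[a b] [c d].
- exact: fset_uniq.
apply/allpairsP/idP => [[[a b] [/= aA bB [-> ->]]]|]; first by rewrite inE /= aA.
by rewrite inE /= => /andP[xA yB]; exists (x, y).
Qed.

(** * Generating series *)

Section Series.
Variables (W : groupType) (S : {fset W}) (N : W -> {fset W}).
Hypothesis hN : inversion_cocycle S N.
Implicit Types (I J : {fset W}) (A B : set W) (w v s t x y u z : W).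

Local Notation len w := (#|` N w%g|).

(** Coefficients are computed as sums over these finite balls because W may be infinite; any radius
    that is large enough gives the same value. *)
Definition length_ball (m : nat) : set W :=
  [set w | parabolic S w /\ (len w <= m)%N]%classic.

Lemma finite_length_ball m : finite_set (length_ball m).
Proof.
suff [B hB] : exists B : {fset W}, forall w, parabolic S w -> (len w <= m)%N -> w \in B.
  apply: (sub_finite_set (B := [set` B])) => [w [wS wm]|]; first exact: hB.
  exact: finite_fset.
elim: m => [|m [B hB]].
  exists [fset 1] => w wS; rewrite leqn0 => /eqP w0.
  by rewrite (len_eq0 hN wS w0) inE.
exists (1 |` [fset s * w | s in S, w in B]) => w wS lw.
have [->|/eqP w1] := eqVneq w 1; first by rewrite !inE eqxx.
have [s sS sw] := exists_descent hN wS w1.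
rewrite !inE; apply/orP; right; apply/imfset2P; exists s => //; exists (s * w).
  apply: hB; first by apply: parabolicM => //; exact: parabolic_gen.
  by move: lw; rewrite (len_descent hN sS sw).
by rewrite (cocycle_genK hN).
Qed.

Definition fball m := fset_set (length_ball m).

Lemma fballP m w : reflect (parabolic S w /\ (len w <= m)%N) (w \in fball m).
Proof.
by apply: (iffP idP); rewrite in_fset_set ?inE //; exact: finite_length_ball.
Qed.

Local Open Scope ring_scope.

Lemma gen_series_coef A n m : (A `<=` parabolic S)%classic -> (n <= m)%N ->
  gen_series S A n = \sum_(w <- fball m) (`[< A w >] && (len w == n))%:R.
Proof.
move=> AS nm; rewrite /= -natr_sum; congr (_%:R).
under [RHS]eq_bigr do rewrite -[nat_of_bool _]/(if _ then _ else _).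
set X := fset_set _.
have cl v : A v -> clength S v = len v by move=> Av; rewrite (clength_cocycle hN) //;
  exact: AS.
have XP w : (w \in X) = `[< A w >] && (len w == n).
  rewrite in_fset_set; last first.
    apply: (sub_finite_set (B := length_ball n)); last exact: finite_length_ball.
    by move=> v [Av /=]; rewrite cl // => <-; split=> //; exact: AS.
  apply/idP/andP => [|[/asboolP Aw /eqP lw]]; rewrite inE.
    by move=> [Aw /= <-]; rewrite cl //; split=> //; exact/asboolP.
  by split=> //=; rewrite cl.
rewrite card_fset_sum1 -(@big_fset_incl _ _ _ _ X (fball m)) /=.
- by apply: eq_big_seq => w wX; rewrite -XP wX.
- apply/fsubsetP => w; rewrite XP => /andP[/asboolP Aw /eqP lw].
  by apply/fballP; rewrite lw; split=> //; exact: AS.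
- by move=> w _; rewrite XP => /negbTE ->.
Qed.

Lemma subst_coef k A n m : (0 < k)%N -> (A `<=` parabolic S)%classic -> (n <= m)%N ->
  fps_subst_exp k (gen_series S A) n =
  \sum_(w <- fball m) (`[< A w >] && (k * len w == n)%N)%:R.
Proof.
move=> k0 AS nm; change (fps_subst_exp k (gen_series S A) n) with
  (if (k %| n)%N then gen_series S A (n %/ k)%N else 0).
case: ifP => kn; last first.
  rewrite big1 // => w _; case: eqP => [e|_]; last by rewrite andbF.
  by move: kn; rewrite -e dvdn_mulr.
rewrite (gen_series_coef AS (leq_trans (leq_div n k) nm)).
apply: eq_bigr => w _; congr (nat_of_bool (_ && _))%:R.
by rewrite -{2}(divnK kn) mulnC eqn_pmul2r.
Qed.

Lemma conv_coef k l A B n m : (0 < k)%N -> (0 < l)%N -> (A `<=` parabolic S)%classic ->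
    (B `<=` parabolic S)%classic -> (n <= m)%N ->
  (fps_subst_exp k (gen_series S A) * fps_subst_exp l (gen_series S B)) n =
  \sum_(p <- fball m `*` fball m)
    [&& `[< A p.1 >], `[< B p.2 >] & (k * len p.1 + l * len p.2 == n)%N]%:R.
Proof.
move=> k0 l0 AS BS nm; rewrite fps_coefM.
transitivity (\sum_(i < n.+1) \sum_(u <- fball m) \sum_(x <- fball m)
    ((`[< A u >] && (k * len u == i)%N)%:R * (`[< B x >] && (l * len x == n -
      i)%N)%:R) : rat).
  apply: eq_bigr => i _; rewrite (subst_coef k0 AS (m := m)); last first.
    by apply: leq_trans nm; rewrite -ltnS.
  rewrite (subst_coef l0 BS (m := m)); last exact: (leq_trans (leq_subr _ _)).
  by rewrite big_distrl; apply: eq_bigr => u _; rewrite big_distrr.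
rewrite -(sum_pair _ _ (fun u x => [&& `[< A u >], `[< B x >] & (k * len u + l * len
  x == n)%N]%:R)).
rewrite exchange_big; apply: eq_bigr => u _; rewrite exchange_big;
  apply: eq_bigr => x _ /=.
case: (`[< A u >]); last by rewrite big1 // => i _; rewrite mul0r.
case: (`[< B x >]); last by rewrite big1 // => i _; rewrite mulr0.
rewrite /=; have [h|h] := leqP (k * len u) n; last first.
  rewrite big1 => [|i _]; last by rewrite (gtn_eqF (leq_trans (ltn_ord i) h)) mul0r.
  by rewrite gtn_eqF // (leq_trans h) // leq_addr.
rewrite (bigD1 (Ordinal (h : k * len u < n.+1)%N)) //= eqxx mul1r big1 ?addr0.
  by rewrite -[in RHS](subnKC h) eqn_add2l.
move=> i ne; suff -> : (k * len u == i)%N = false by rewrite mul0r.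
by apply: contraNF ne => /eqP e; apply/eqP/val_inj.
Qed.

End Series.

Lemma fps_subst_exp1 (R : comNzRingType) (f : fps R) : fps_subst_exp 1 f = f.
Proof. by apply: fpsP => n /=; rewrite dvd1n divn1. Qed.

(** * The signed sum of the series, coefficient by coefficient *)

Section MainIdentity.
Variables (W : groupType) (S : {fset W}) (N : W -> {fset W}).
Hypothesis hN : inversion_cocycle S N.
Implicit Types (I J : {fset W}) (A B : set W) (w v s t x y u z : W).

Local Notation len w := (#|` N w%g|).
Local Notation fball := (fball S N).

Definition min_reps I : set W := [set x | parabolic S x /\ lmin N I x^-1]%classic.

Lemma min_reps_sub I : (min_reps I `<=` parabolic S)%classic.
Proof. by move=> x []. Qed.

Let sum_ind (T : choiceType) (X : {fset T}) (P : pred T) :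
  (\sum_(p <- X) (P p)%:R = \sum_(p <- X | P p) 1 :> rat)%R.
Proof. by rewrite [RHS]big_mkcond; apply: eq_bigr => p _; case: (P p). Qed.

Lemma rmin_proj I : I `<=` S -> exists pm : W -> W, forall w, parabolic S w ->
  [/\ parabolic S (pm w), lmin N I (pm w)^-1 & parabolic I ((pm w)^-1 * w)].
Proof.
move=> IS; suff h w : exists x, parabolic S w ->
    [/\ parabolic S x, lmin N I x^-1 & parabolic I (x^-1 * w)].
  by have [pm hpm] := choice h; exists pm.
have [wS|nw] := pselect (parabolic S w); last by exists 1.
have [x [u [xS uI xm ->]]] := rmin_decomp hN IS wS.
by exists x; rewrite mulKg.
Qed.

Lemma rmin_proj_uniq I x x' : I `<=` S -> parabolic S x -> parabolic S x' ->
  lmin N I x^-1 -> lmin N I x'^-1 -> parabolic I (x^-1 * x') -> x' = x.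
Proof.
move=> IS xS x'S xm x'm h.
by apply: (rmin_uniq hN IS xS x'S xm x'm h); rewrite mulVKg.
Qed.

(** Each w factors uniquely as x * u with x shortest in x W_I and u in W_I, and lengths add. *)
Lemma gen_series_factor I k : I `<=` S -> (0 < k)%N ->
  (fps_subst_exp k (gen_series S (parabolic I)) *
   fps_subst_exp k (gen_series S (min_reps I)) =
   fps_subst_exp k (gen_series S (parabolic S)))%R.
Proof.
move=> IS k0; apply: fpsP => n.
rewrite (conv_coef hN k0 k0 (parabolicS IS) (@min_reps_sub I) (leqnn n)).
rewrite (subst_coef hN k0 (@subset_refl _ _) (leqnn n)) !sum_ind.
have [pm hpm] := rmin_proj IS.
apply: (sum_reindex (f := fun p => p.2 * p.1) (g := fun w => ((pm w)^-1 * w, pm w))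
    (fun=> 1%R)) => [[u x] _ /= /and3P[/asboolP uI /asboolP[xS xm] /eqP e]|w /(fballP
      hN)[wS lw]].
  have uS := parabolicS IS uI.
  have xuS : parabolic S (x * u) by exact: parabolicM.
  have lxu := rmin_add hN IS xS xm uI.
  have e' : (k * len (x * u) = n)%N by rewrite lxu mulnDr addnC.
  have [pS pmin pI] := hpm _ xuS.
  have -> : pm (x * u) = x.
    apply: (rmin_proj_uniq IS xS pS xm pmin); apply/parabolicV.
    by rewrite invgM invgK; apply/(parabolicMr _ uI); rewrite -mulgA.
  split; [apply/(fballP hN); split=> //| |by rewrite mulKg].
    by rewrite -e' leq_pmull.
  by apply/andP; split; [exact/asboolP|exact/eqP].
move=> /andP[_ /eqP e]; have [pS pmin pI] := hpm _ wS; set x := pm w in pS pmin pI *.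
have lw' : len w = (len x + len (x^-1 * w))%N.
  by rewrite -(rmin_add hN IS pS pmin pI) mulVKg.
split; last by rewrite /= mulVKg.
  rewrite inE /=; apply/andP; split; apply/(fballP hN); split => //.
  - exact: parabolicS pI.
  - by apply: leq_trans lw; rewrite lw' leq_addl.
  - by apply: leq_trans lw; rewrite lw' leq_addr.
by apply/and3P; split=> /=; [exact/asboolP|exact/asboolP|rewrite -mulnDr addnC -lw' e].
Qed.

Variable star : {multiplicative W -> W}.
Hypothesis hs : involutive star.
Hypothesis hS : star_stable star S.
Variable C : set W.
Hypothesis CS : (C `<=` parabolic S)%classic.
Hypothesis Ctw : forall z, C z -> star z = z^-1.
Hypothesis Ccl : forall z x, C z -> parabolic S x -> C (x^-1 * z * star x).
Variable red : W -> W.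
Hypothesis redP : forall z, C z -> let z0 := (red z)^-1 * z * star (red z) in
  [/\ parabolic S (red z), len z = (2 * len (red z) + len z0)%N &
    forall s, s \in S -> s \in N z0 -> s * z0 = z0 * star s].

Local Notation r := (star_orbits star).
Local Notation asc x := (star_ascents N star S x).

Let red_conj z := (red z)^-1 * z * star (red z).
(** The exponent attached to z and to the coset (red z * x) W_I. It does not mention I, so all I
    with the same x can be grouped together. *)
Let weight z x := (len z + 2 * #|` N (red z * x) `\` N z|)%N.

Let red_sub z : C z -> N (red z) `<=` N z.
Proof.
move=> Cz; have [vS lz _] := redP Cz; rewrite -/(red_conj z) in lz.
have zE : z = red z * (red_conj z * (star (red z))^-1).
  by rewrite /red_conj !mulgA mulgV mul1g mulgK.
rewrite [in X in _ `<=` X]zE; apply: (len_add_sub hN); rewrite -zE lz.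
rewrite mul2n -addnn -addnA leq_add2l addnC; apply: (leq_trans (len_le hN _ _)).
by rewrite (lenV hN) (len_star hN hs hS).
Qed.

(** 2 l(red z) <= l(z) <= n, and [N (red z * x)] has at most n walls in [N z] and at most n outside.
    The constant 4 is a generous bound that makes the sums over x finite. *)
Let weight_bound z x n : C z -> weight z x = n ->
  (len z <= n)%N /\ (len x <= 4 * n)%N.
Proof.
move=> Cz wn; have [vS lz _] := redP Cz.
have zn : (len z <= n)%N by rewrite -wn leq_addr.
split=> //; have xE : x = (red z)^-1 * (red z * x) by rewrite mulKg.
have l1 := len_le hN (red z)^-1 (red z * x); rewrite -xE (lenV hN) in l1.
have l2 := cardfsID (N z) (N (red z * x)).
have l3 := fsubset_leq_card (fsubsetIr (N (red z * x)) (N z)).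
move: wn lz l1 l2 l3 zn; rewrite /weight.
move: (len _) (len _) (len _) (len _) (#|` _|) (#|` _|) => a b c d e f; lia.
Qed.

Local Open Scope ring_scope.

(** The pair (u, x) corresponds to (z, x'), where z = x * u * (star x)^-1 and x' is the shortest
    element of (red z)^-1 x W_I; conversely x is the shortest element of red z x' W_I. *)
Let fixed_term I n : I `<=` S -> star_stable star I ->
  (gen_series S (C `&` parabolic I)%classic * fps_subst_exp 2 (gen_series S (min_reps
    I))) n =
  \sum_(z <- fball n) \sum_(x <- fball (4 * n)%N)
    [&& `[< C z >], weight z x == n, lmin N I x^-1 &
        `[< parabolic I (x^-1 * red_conj z * star x)%g >] ]%:R.
Proof.
move=> IS Ist; rewrite -{1}[gen_series S _]fps_subst_exp1.
have CIS : (C `&` parabolic I `<=` parabolic S)%classic by move=> z [/CS].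
rewrite (conv_coef hN _ _ CIS (@min_reps_sub I) (leqnn n)) //.
rewrite (sum_pair _ _ (fun z x => [&& `[< C z >], weight z x == n, lmin N I x^-1 &
        `[< parabolic I (x^-1 * red_conj z * star x)%g >] ]%:R)) !sum_ind.
have [pm hpm] := rmin_proj IS.
(* When x and red z * x' lie in one coset of W_I, the two conditions for that coset to be fixed
   agree, and [twisted_weight] with [rmin_walls] identifies the exponents. *)
have key z x x' (u := (x^-1 * z * star x)%g) : C z -> parabolic S x -> parabolic S x' ->
    lmin N I x^-1 -> lmin N I x'^-1 -> parabolic I ((red z * x')^-1 * x)%g ->
  [/\ parabolic I u <-> parabolic I (x'^-1 * red_conj z * star x')%g &
      parabolic I u -> weight z x' = (1 * len u + 2 * len x)%N].
Proof.
  move=> Cz xS x'S xm x'm bI; set b := ((red z * x')^-1 * x)%g in bI.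
  have xE : x = (red z * x' * b)%g by rewrite /b mulVKg.
  have sbI : parabolic I (star b) by exact/(parabolic_star hN hs).
  have uE : u = (b^-1 * (x'^-1 * red_conj z * star x') * star b)%g.
    by rewrite /u xE /red_conj !gmulfM !invgM !mulgA.
  split.
    rewrite uE; split=> [/(parabolicMr _ sbI)/parabolicMl|h]; first by apply;
      exact/parabolicV.
    by apply: parabolicM => //; apply: parabolicM => //; exact/parabolicV.
  move=> uI; rewrite /weight -(rmin_walls hN IS xS x'S bI xm x'm xE (red_sub Cz)).
  have := twisted_weight hN hs hS IS (CS Cz) (Ctw Cz) xS xm uI.
  by rewrite mul1n addnC => ->.
apply: (sum_reindex
  (f := fun p => ((p.2 * p.1 * (star p.2)^-1)%g,
                  pm ((red (p.2 * p.1 * (star p.2)^-1)%g)^-1 * p.2)%g))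
  (g := fun q => (((pm (red q.1 * q.2)%g)^-1 * q.1 * star (pm (red q.1 * q.2)%g))%g,
                  pm (red q.1 * q.2)%g)) (fun=> 1))
  => [[u x] /=|[z x'] /=].
  rewrite !inE /= => _ /and3P[/asboolP[Cu uI] /asboolP[xS xm] /eqP wn].
  pose z : W := (x * u * (star x)^-1)%g; rewrite -/z.
  have xVS : parabolic S (x^-1)%g by exact/parabolicV.
  have Cz : C z by have := Ccl Cu xVS; rewrite invgK multiplicativeV.
  have uE : u = (x^-1 * z * star x)%g by rewrite /z !mulgA mulVg mul1g mulgVK.
  have [vS _ _] := redP Cz.
  have vxS : parabolic S ((red z)^-1 * x)%g by apply: parabolicM => //; exact/parabolicV.
  have [x'S x'm bI] := hpm _ vxS; set x' := pm _ in x'S x'm bI *.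
  have bI' : parabolic I ((red z * x')^-1 * x)%g by rewrite invgM -mulgA.
  have := key z x x' Cz xS x'S xm x'm bI'; rewrite -uE => -[e1 e2].
  have w1 : weight z x' = n by rewrite e2.
  have [zn xn] := weight_bound Cz w1.
  split.
  - by apply/andP; split; apply/(fballP hN); split=> //; exact: CS.
  - by apply/and4P; split; [exact/asboolP|exact/eqP|exact: x'm|apply/asboolP/e1].
  have rxS : parabolic S (red z * x')%g by exact: parabolicM.
  have [pS pmin pI] := hpm _ rxS.
  have -> : pm (red z * x')%g = x.
    apply: (rmin_proj_uniq IS xS pS xm pmin); apply/parabolicV.
    rewrite invgM invgK -(mulVKg (red z * x')%g x) mulgA.
    exact: parabolicM.
  by rewrite -uE.
rewrite !inE /= => /andP[_ /(fballP hN)[x'S _]] /and4P[/asboolP Cz /eqP wn x'm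
  /asboolP yI].
have [vS _ _] := redP Cz.
have vxS : parabolic S (red z * x')%g by exact: parabolicM.
have [xS xm bI] := hpm _ vxS; set x := pm _ in xS xm bI *.
have bI' : parabolic I ((red z * x')^-1 * x)%g by apply/parabolicV; rewrite invgM invgK.
have [e1 e2] := key z x x' Cz xS x'S xm x'm bI'.
have uI : parabolic I (x^-1 * z * star x)%g by exact/e1.
have wu := e2 uI; rewrite wn in wu.
have zE : (x * (x^-1 * z * star x) * (star x)^-1)%g = z by rewrite !mulgA mulgV mul1g
  mulgK.
split.
- apply/andP; split; apply/(fballP hN); split=> //.
  + exact: parabolicS uI.
  + by rewrite wu mul1n leq_addr.
  + by rewrite wu -{1}[len x]mul1n; apply: leq_trans (leq_addl _ _);
    rewrite leq_mul2r orbT.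
- apply/and3P; split; last by rewrite -wu.
  + by apply/asboolP; split=> //; exact: Ccl.
  + exact/asboolP.
rewrite zE; congr (_, _).
have vxS' : parabolic S ((red z)^-1 * x)%g by apply: parabolicM => //; exact/parabolicV.
have [pS pmin pI] := hpm _ vxS'.
apply: (rmin_proj_uniq IS x'S pS x'm pmin).
set p := pm _ in pI *.
have -> : (x'^-1 * p = (red z * x')^-1 * x * (p^-1 * ((red z)^-1 * x))^-1)%g.
  by rewrite !invgM !invgK !mulgA mulgK mulgVK.
by apply: parabolicM => //; exact/parabolicV.
Qed.

(** After exchanging the sums, the conditions on I say that I is a subset of [asc x] whose parabolic
    subgroup contains the twisted conjugate of [red_conj z]. *)
Lemma series_coef n :
  (\sum_(I <- fpowerset S | star_stable star I) (-1) ^+ r I *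
     (gen_series S (C `&` parabolic I)%classic * fps_subst_exp 2 (gen_series S
       (min_reps I)))) n =
  \sum_(z <- fball n) \sum_(x <- fball (4 * n)%N) (`[< C z >] && (weight z x == n))%:R *
     signed_sum S star (asc x) (x^-1 * red_conj z * star x)%g.
Proof.
rewrite fps_coef_sum.
have signE (f : fps rat) k : ((-1) ^+ k * f) n = (-1) ^+ k * f n.
  by rewrite -!(signr_odd _ k); case: (odd k); rewrite ?expr1 ?expr0 ?mulN1r ?mul1r.
under eq_bigr do rewrite signE.
transitivity (\sum_(I <- fpowerset S | star_stable star I)
  \sum_(z <- fball n) \sum_(x <- fball (4 * n)%N) (-1) ^+ r I *
    [&& `[< C z >], weight z x == n, lmin N I (x^-1)%g &
        `[< parabolic I (x^-1 * red_conj z * star x)%g >] ]%:R : rat).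
  rewrite big_seq_cond [RHS]big_seq_cond; apply: eq_bigr => I.
  rewrite fpowersetE => /andP[IS Ist]; rewrite fixed_term // big_distrr.
  by apply: eq_bigr => z _; rewrite big_distrr.
rewrite exchange_big; apply: eq_bigr => z _; rewrite exchange_big;
  apply: eq_bigr => x _ /=.
rewrite /signed_sum big_distrr big_mkcondr big_seq_cond [RHS]big_seq_cond.
apply: eq_bigr => I; rewrite fpowersetE => /andP[IS Ist].
rewrite (lmin_asc N hs x Ist IS).
case: (`[< C z >]) => //=; last by rewrite mulr0 mul0r if_same.
case: (weight z x == n) => //=; last by rewrite mulr0 mul0r if_same.
by rewrite mul1r; case: (_ && _); rewrite ?mulr1 ?mulr0.
Qed.



Let twisted_core z : C z ->
  [/\ parabolic S (red_conj z), star (red_conj z) = (red_conj z)^-1%g &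
      forall s, s \in S -> s \in N (red_conj z) ->
        (s * red_conj z = red_conj z * star s)%g].
Proof.
move=> Cz; have [vS _ h] := redP Cz; split=> //.
  by apply: (parabolic_twist hN hs hS) => //; exact: CS.
by apply: (twisted_conj hs); exact: Ctw.
Qed.

Let core_longest z x : C z -> parabolic S x ->
    signed_sum S star (asc x) (x^-1 * red_conj z * star x)%g <> 0 ->
  S `<=` N (red_conj z * star x)^-1%g.
Proof.
move=> Cz xS; have [zS zst zc] := twisted_core Cz.
move=> /(signed_sum_nz hN hs hS (asc_stable N hs hS x) (asc_sub S N star x))[yA ysupp].
exact: (extremal_longest hN hs hS zS zst zc xS yA ysupp).
Qed.

Local Notation lhs := (\sum_(I <- fpowerset S | star_stable star I) (-1) ^+ r I *
  (gen_series S (C `&` parabolic I)%classic * fps_subst_exp 2 (gen_series S (min_reps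
    I)))).

Lemma longest_finite w : parabolic S w -> S `<=` N w -> finite_set (parabolic S).
Proof.
move=> wS Sw; apply: (sub_finite_set (B := length_ball S N (len w))).
  by move=> u uS; split=> //; exact: (longest_max hN Sw wS uS).
exact: finite_length_ball.
Qed.

(** A nonzero signed sum would produce an element with every generator as a descent, and such an
    element bounds all lengths. *)
Lemma series_sum_infinite : infinite_set (parabolic S) -> lhs = 0.
Proof.
move=> infS; apply: fpsP => n; rewrite series_coef [RHS]fps_coef0.
rewrite big1_seq // => z _; rewrite big1_seq // => x /= /(fballP hN)[xS _].
case: asboolP => [Cz|_]; last by rewrite mul0r.
have [zS _ _] := twisted_core Cz.
set sg := signed_sum _ _ _ _; suff -> : sg = 0 by rewrite mulr0.
apply: contrapT => /(core_longest Cz xS) h; apply: infS; apply: longest_finite h.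
apply/parabolicV; apply: parabolicM => //; exact/(parabolic_star hN hs).
Qed.

Lemma series_sum_finite w0 : parabolic S w0 -> S `<=` N w0 ->
  forall n, lhs n = \sum_(z <- fball n)
    (`[< C z >] && (2 * len w0 - len z == n)%N)%:R * (-1) ^+ len z.
Proof.
move=> w0S Sw0 n; have finS := longest_finite w0S Sw0.
rewrite series_coef; apply: eq_bigr => z _.
case: asboolP => [Cz|_]; last by rewrite big1 ?mul0r // => x _; rewrite mul0r.
have [zS zst zc] := twisted_core Cz; have [vS lz _] := redP Cz.
rewrite -/(red_conj z) in lz.
have w0st := longest_star hN hs hS w0S Sw0.
set x0 := (red_conj z * w0)%g.
have x0S : parabolic S x0 by exact: parabolicM.
have wx0 : weight z x0 = (2 * len w0 - len z)%N.
  exact: (extremal_weight hN hs hS w0S Sw0 (CS Cz) (Ctw Cz) vS lz).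
(* A nonzero signed sum makes the inverse of red_conj z * star x equal to w0, which determines x. *)
have other x : parabolic S x -> x != x0 ->
    signed_sum S star (asc x) (x^-1 * red_conj z * star x)%g = 0.
  move=> xS ne; apply: contrapT => /(core_longest Cz xS) h.
  case/eqP: ne; have gS : parabolic S (red_conj z * star x)^-1%g.
    by apply/parabolicV; apply: parabolicM => //; exact/(parabolic_star hN hs).
  have e := longest_uniq hN Sw0 w0S h gS.
  have e' : star x = ((red_conj z)^-1 * w0)%g.
    by rewrite -(longestV hN Sw0 w0S) -e invgK mulKg.
  by rewrite -[x]hs e' gmulfM multiplicativeV zst invgK w0st.
have [wn|wn] := eqVneq (2 * len w0 - len z)%N n; last first.
  rewrite mul0r big1_seq // => x /= /(fballP hN)[xS _].
  have [->|ne] := eqVneq x x0; first by rewrite wx0 (negbTE wn) mul0r.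
  by rewrite other ?mulr0.
have [zn xn] := weight_bound Cz (etrans wx0 wn).
rewrite (sum_single (x := x0)) /=; last 2 first.
- exact/(fballP hN).
- by move=> x /(fballP hN)[xS _] ne; rewrite other ?mulr0.
rewrite wx0 wn eqxx !mul1r.
have [yA ysupp] := extremal_exists hN hs hS w0S Sw0 zS zst zc.
rewrite -/x0 in yA ysupp.
have Ast := asc_stable N hs hS x0; have AS := asc_sub S N star x0.
have [Ay yc ly] := extremal_descents hN hs hS zS zst zc x0S yA ysupp.
rewrite (signed_sum_sign hs Ast AS yA ysupp).
have finA : finite_set (parabolic (asc x0)) := sub_finite_set (parabolicS AS) finS.
(* The twisted conjugate y is longest in the parabolic subgroup of [asc x0] and intertwines star
   there. So the sign is (-1)^l(y), where l(y) = l(z0) has the parity of l(z). *)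
rewrite -(longest_parity (sub_cocycle hN AS) hs Ast yA Ay yc finA) ly lz.
by rewrite exprD mulnC exprM sqrr_sign mul1r.
Qed.

End MainIdentity.

Local Open Scope ring_scope.

(** * Polynomials and rational functions as power series *)

Section FpsOfPoly.
Variable R : comNzRingType.

Lemma fps_of_polyD (p q : {poly R}) : fps_of_poly (p + q) = fps_of_poly p + fps_of_poly q.
Proof. by apply: fpsP => n; rewrite fps_coefD /= coefD. Qed.

Lemma fps_of_polyM (p q : {poly R}) : fps_of_poly (p * q) = fps_of_poly p * fps_of_poly q.
Proof. by apply: fpsP => n; rewrite fps_coefM /= coefM. Qed.

Lemma fps_of_poly0 : fps_of_poly (0 : {poly R}) = 0.
Proof. by apply: fpsP => n; rewrite fps_coef0 /= coef0. Qed.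

Lemma fps_of_poly1 : fps_of_poly (1 : {poly R}) = 1.
Proof. by apply: fpsP => n; rewrite fps_coef1 /= coef1. Qed.

Lemma fps_of_poly_inj : injective (@fps_of_poly R).
Proof. by move=> p q e; apply/polyP => n; move/(congr1 (fun f : fps R => f n)): e. Qed.

Lemma fps_of_poly_sum (I : Type) (s : seq I) (P : pred I) (F : I -> {poly R}) :
  fps_of_poly (\sum_(i <- s | P i) F i) = \sum_(i <- s | P i) fps_of_poly (F i).
Proof. exact: (big_morph _ fps_of_polyD fps_of_poly0). Qed.

Lemma fps_of_poly_sign k (p : {poly R}) :
  fps_of_poly ((-1) ^+ k * p) = (-1) ^+ k * fps_of_poly p.
Proof.
rewrite -!(signr_odd _ k); case: (odd k); rewrite ?expr1 ?expr0 ?mul1r // !mulN1r.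
by apply: fpsP => n; rewrite fps_coefN /= coefN.
Qed.

Lemma fps_subst_poly k (p : {poly R}) : (0 < k)%N ->
  fps_subst_exp k (fps_of_poly p) = fps_of_poly (p \Po 'X^k).
Proof. by move=> k0; apply: fpsP => n /=; rewrite coef_comp_poly_Xn. Qed.

End FpsOfPoly.

Lemma fps_unitE (f : fps rat) : (f \is a GRing.unit) = (f 0%N != 0).
Proof. by rewrite -[LHS]/(f 0%N \is a GRing.unit) unitfE. Qed.

Lemma fps_rationalP (f : fps rat) : fps_rational f <->
  exists P Q : {poly rat}, Q.[0] != 0 /\ f * fps_of_poly Q = fps_of_poly P.
Proof.
split=> -[P [Q [Q0 e]]]; exists P, Q; split=> //.
  by rewrite e divrK // fps_unitE /= -horner_coef0.
by rewrite -e mulrK // fps_unitE /= -horner_coef0.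
Qed.

Lemma fps_rational_poly p : fps_rational (fps_of_poly p).
Proof.
by apply/fps_rationalP; exists p, 1; rewrite hornerC oner_neq0 fps_of_poly1 mulr1.
Qed.

Lemma fps_rationalM f g : fps_rational f -> fps_rational g -> fps_rational (f * g).
Proof.
move=> /fps_rationalP[P [Q [Q0 e]]] /fps_rationalP[P' [Q' [Q0' e']]].
apply/fps_rationalP; exists (P * P'), (Q * Q').
by rewrite hornerM mulf_neq0 // !fps_of_polyM mulrACA e e'.
Qed.

Lemma fps_rationalD f g : fps_rational f -> fps_rational g -> fps_rational (f + g).
Proof.
move=> /fps_rationalP[P [Q [Q0 e]]] /fps_rationalP[P' [Q' [Q0' e']]].
apply/fps_rationalP; exists (P * Q' + P' * Q), (Q * Q').
rewrite hornerM mulf_neq0 // fps_of_polyD !fps_of_polyM mulrDl mulrA e.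
by rewrite [fps_of_poly Q * _]mulrC mulrA e'.
Qed.

Lemma fps_rational_sign k f : fps_rational f -> fps_rational ((-1) ^+ k * f).
Proof.
move=> h; apply: fps_rationalM => //; have := fps_rational_poly ((-1) ^+ k * 1).
by rewrite fps_of_poly_sign fps_of_poly1 mulr1.
Qed.

Lemma fps_rational_sum (T : eqType) (s : seq T) (P : pred T) F :
    (forall i, i \in s -> P i -> fps_rational (F i)) ->
  fps_rational (\sum_(i <- s | P i) F i).
Proof.
move=> h; rewrite big_seq_cond; elim/big_ind: _ => [||i /andP[]].
- by rewrite -fps_of_poly0; exact: fps_rational_poly.
- exact: fps_rationalD.
- exact: h.
Qed.

Lemma fps_rationalV f : f \is a GRing.unit -> fps_rational f -> fps_rational f^-1.
Proof.
move=> fU /fps_rationalP[P [Q [Q0 e]]]; apply/fps_rationalP; exists Q, P.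
split; last by rewrite -e mulKr.
rewrite horner_coef0 -[_`_0]/(fps_of_poly P 0%N) -fps_unitE -e unitrM fU.
by rewrite fps_unitE /= -horner_coef0.
Qed.

(** The exponent is an integer, so that n = 0 gives (-1)^-1 = -1; this occurs for empty S. *)
Lemma exprN1_pred (R : unitRingType) (n : nat) :
  (-1 : R) ^ (n%:Z - 1) = - (-1) ^+ n.
Proof.
case: n => [|n]; first by rewrite expr0 sub0r exprN1 invrN1.
by rewrite intS addrC addKr exprSr mulrN1 opprK.
Qed.

(** * The identities for infinite groups *)

Section GenSeries.
Variables (W : groupType) (S : {fset W}) (N : W -> {fset W}).
Hypothesis hN : inversion_cocycle S N.

Local Notation len w := (#|` N w%g|).

(** Both lengths count the same walls; this lets identities for the system (W_I, I) be read in W. *)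
Lemma gen_series_sub I (A : set W) : I `<=` S -> (A `<=` parabolic I)%classic ->
  gen_series I A = gen_series S A.
Proof.
move=> IS AI; apply: fpsP => n /=.
suff -> : (A `&` [set w | clength I w = n] = A `&` [set w | clength S w = n])%classic
  by [].
apply/seteqP; split=> w [Aw /= <-]; split=> //=; have wI := AI _ Aw;
by rewrite (clength_cocycle hN (parabolicS IS wI)) (clength_cocycle (sub_cocycle hN
  IS) wI).
Qed.

Lemma gen_series_parabolic_unit I k : I `<=` S -> (0 < k)%N ->
  fps_subst_exp k (gen_series S (parabolic I)) \is a GRing.unit.
Proof.
move=> IS k0; rewrite fps_unitE (subst_coef hN k0 (parabolicS IS) (leqnn 0%N)).
rewrite (sum_single (x := 1%g)) /=.
- have -> : `[< parabolic I 1%g >] by apply/asboolP; exact: parabolic1.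
  by rewrite (cocycle1 hN) cardfs0 muln0.
- by apply/(fballP hN); split; [exact: parabolic1|rewrite (cocycle1 hN) cardfs0].
move=> w /(fballP hN)[wS]; rewrite leqn0 => /eqP lw.
by rewrite (len_eq0 hN wS lw) eqxx.
Qed.

Lemma sum_split_top (R : zmodType) (P : pred {fset W}) (F : {fset W} -> R) : P S ->
  \sum_(I <- fpowerset S | P I) F I =
  F S + \sum_(I <- fpowerset S | (I `<` S) && P I) F I.
Proof.
move=> PS; rewrite (bigID (fun I => I == S)) /=; congr (_ + _).
  rewrite big_mkcond (sum_single (x := S)) ?fpowersetE ?PS ?eqxx // => I _ /negbTE ->.
  by rewrite andbF.
rewrite big_seq_cond [RHS]big_seq_cond; apply: eq_bigl => I; rewrite fpowersetE.
by rewrite fproperEneq; case: (I `<=` S); rewrite //= andbT andbC.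
Qed.

Variable star : {multiplicative W -> W}.
Hypothesis hs : involutive star.
Hypothesis hS : star_stable star S.
Variable C : set W.
Hypothesis CS : (C `<=` parabolic S)%classic.
Hypothesis Ctw : forall z, C z -> star z = z^-1%g.
Hypothesis Ccl : forall z x, C z -> parabolic S x -> C (x^-1 * z * star x)%g.

Local Notation r := (star_orbits star).
Local Notation term I :=
  (gen_series S (C `&` parabolic I)%classic / fps_subst_exp 2 (gen_series S
    (parabolic I))).

Lemma exists_reduction : exists red : W -> W,
  forall z, C z -> let z0 := ((red z)^-1 * z * star (red z))%g in
  [/\ parabolic S (red z), len z = (2 * len (red z) + len z0)%N &
    forall s, s \in S -> s \in N z0 -> (s * z0 = z0 * star s)%g].
Proof.
suff h z : exists v, C z -> let z0 := (v^-1 * z * star v)%g in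
  [/\ parabolic S v, len z = (2 * len v + len z0)%N &
    forall s, s \in S -> s \in N z0 -> (s * z0 = z0 * star s)%g].
  by have [red hred] := choice h; exists red.
have [Cz|nC] := pselect (C z); last by exists 1%g.
by have [v hv] := twisted_reduction hN hs hS (CS Cz) (Ctw Cz); exists v.
Qed.

(** Multiplication by the unit W(q^2) turns each quotient by W_I(q^2) into a product with the series
    of shortest coset representatives. *)
Lemma infinite_identity : infinite_set (parabolic S) ->
  \sum_(I <- fpowerset S | star_stable star I) (-1) ^+ r I * term I = 0.
Proof.
have [red hred] := exists_reduction.
move=> /(series_sum_infinite hN hs hS CS Ctw Ccl hred) h.
set X := LHS; have WU := gen_series_parabolic_unit (fsubset_refl S) (isT : 0 < 2)%N.
apply: (mulIr WU); rewrite mul0r -[RHS]h /X big_distrl.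
rewrite big_seq_cond [RHS]big_seq_cond; apply: eq_bigr => I.
rewrite fpowersetE => /andP[IS Ist] /=; rewrite -(gen_series_factor hN IS) // -mulrA.
by congr (_ * _); rewrite -mulrA mulKr //; exact: gen_series_parabolic_unit.
Qed.

(** Orbit counts add: r(S) is the sum of r(I) and the number of orbits in the complement of I. *)
Lemma proper_sign_sum (R : unitRingType) (F : {fset W} -> R) :
  \sum_(I <- fpowerset S | (I `<` S) && star_stable star I)
    (-1) ^ ((r (S `\` I))%:Z - 1) * F I =
  - ((-1) ^+ r S * \sum_(I <- fpowerset S | (I `<` S) && star_stable star I)
       (-1) ^+ r I * F I).
Proof.
rewrite big_distrr -sumrN /= big_seq_cond [RHS]big_seq_cond; apply: eq_bigr => I.
rewrite fpowersetE => /and3P[IS _ Ist].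
by rewrite exprN1_pred (star_orbitsD hs hS Ist IS) mulNr exprD -mulrA signrMK.
Qed.

Lemma term_identity : \sum_(I <- fpowerset S | star_stable star I) (-1) ^+ r I * term
  I = 0 ->
  gen_series S (C `&` parabolic S)%classic / fps_subst_exp 2 (gen_series S (parabolic
    S)) =
  \sum_(I <- fpowerset S | (I `<` S) && star_stable star I)
    (-1) ^ ((r (S `\` I))%:Z - 1) * term I.
Proof.
rewrite (sum_split_top _ hS) => /eqP; rewrite addr_eq0 => /eqP h.
by rewrite -[LHS](signrMK (r S)) h mulrN proper_sign_sum.
Qed.

End GenSeries.

(** * Rationality *)

Section Rationality.
Variables (W : groupType) (S : {fset W}) (N : W -> {fset W}).
Hypothesis hN : inversion_cocycle S N.

Local Notation len w := (#|` N w%g|).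

Lemma fps_rationalN f : fps_rational f -> fps_rational (- f).
Proof. by move=> h; rewrite -mulN1r -(expr1 (-1)); exact: fps_rational_sign. Qed.

Lemma gen_series1 : gen_series S [set 1%g]%classic = 1.
Proof.
have sub : ([set 1%g] `<=` parabolic S)%classic by move=> _ ->; exact: parabolic1.
apply: fpsP => n; rewrite (gen_series_coef hN sub (leqnn n)) fps_coef1.
rewrite (sum_single (x := 1%g)) /=.
- have -> : `[< [set 1%g]%classic (1 : W)%g >] by exact/asboolP.
  by rewrite (cocycle1 hN) cardfs0 eq_sym.
- by apply/(fballP hN); split; [exact: parabolic1|rewrite (cocycle1 hN) cardfs0].
by move=> w _ /eqP w1; case: asboolP.
Qed.

(** For infinite W_I, the identity for the trivial star and the class {1} expresses 1 / W_I(q^2)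
    through the same quotients for proper subsets of I. For finite W_I it is the inverse of a
    polynomial that is a unit as a power series. *)
Lemma inv_parabolic_rational I : I `<=` S ->
  fps_rational (fps_subst_exp 2 (gen_series S (parabolic I)))^-1.
Proof.
have [n] := ubnP #|` I|; elim: n I => // n IHn I lI IS; have hI := sub_cocycle hN IS.
have [finI|infI] := pselect (finite_set (parabolic I)).
  apply: fps_rationalV; first exact: (gen_series_parabolic_unit hN).
  by rewrite gen_series_finite // fps_subst_poly //; exact: fps_rational_poly.
pose id_star : {multiplicative W -> W} := idfun.
have id_stable K : star_stable id_star K by rewrite /star_stable imfset_id.
have C1 : ([set 1%g] `<=` parabolic I)%classic by move=> _ ->; exact: parabolic1.
have C2 z : [set 1%g]%classic z -> id_star z = (z^-1)%g by move=> ->; rewrite invg1.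
have C3 z x : [set 1%g]%classic z -> parabolic I x ->
    [set 1%g]%classic (x^-1 * z * id_star x)%g by move=> -> _; rewrite /= mulg1 mulVg.
have id_inv : involutive id_star by [].
have := infinite_identity hI id_inv (id_stable I) C1 C2 C3 infI.
rewrite (sum_split_top _ (id_stable I)) => /eqP; rewrite addr_eq0 => /eqP e.
have term_eq K : K `<=` I -> gen_series I ([set 1%g] `&` parabolic K)%classic /
    fps_subst_exp 2 (gen_series I (parabolic K)) =
    (fps_subst_exp 2 (gen_series S (parabolic K)))^-1.
  move=> KI; rewrite (gen_series_sub hN IS (parabolicS KI)).
  rewrite (_ : _ `&` _ = [set 1%g])%classic ?(gen_series1) ?mul1r //.
    by rewrite (gen_series_sub hN IS) ?gen_series1 ?mul1r // => _ ->; exact: parabolic1.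
  by apply/seteqP; split=> w [] // ->; split=> //; exact: parabolic1.
rewrite term_eq ?fsubset_refl // in e.
rewrite -[X in fps_rational X](signrMK (star_orbits id_star I)) e.
apply: fps_rational_sign; apply: fps_rationalN; apply: fps_rational_sum => K.
rewrite fpowersetE => KI /andP[KI' _]; rewrite term_eq //; apply: fps_rational_sign.
apply: IHn; last exact: fsubset_trans IS.
by rewrite -ltnS (leq_trans _ lI) // ltnS fproper_ltn_card.
Qed.

Variable star : {multiplicative W -> W}.
Hypothesis hs : involutive star.
Hypothesis hS : star_stable star S.
Variable C : set W.
Hypothesis CS : (C `<=` parabolic S)%classic.
Hypothesis Ctw : forall z, C z -> star z = z^-1%g.
Hypothesis Ccl : forall z x, C z -> parabolic S x -> C (x^-1 * z * star x)%g.

(** The same induction on I isolates the quotient for I itself; multiplying by W_I(q^2), which is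
    rational because its inverse is, recovers the class series. *)
Lemma twisted_class_rational I : I `<=` S -> star_stable star I ->
  fps_rational (gen_series S (C `&` parabolic I)%classic).
Proof.
have [n] := ubnP #|` I|; elim: n I => // n IHn I lI IS Ist; have hI := sub_cocycle hN IS.
have [finI|infI] := pselect (finite_set (parabolic I)).
  by rewrite gen_series_finite; [exact: fps_rational_poly|exact: finite_setIr].
have CI : (C `&` parabolic I `<=` parabolic I)%classic by move=> z [].
have C2 z : (C `&` parabolic I)%classic z -> star z = (z^-1)%g by move=> [/Ctw].
have C3 z x : (C `&` parabolic I)%classic z -> parabolic I x ->
    (C `&` parabolic I)%classic (x^-1 * z * star x)%g.
  move=> [Cz zI] xI; split; first by apply: Ccl => //; exact: (parabolicS IS xI).
  exact: (parabolic_twist hN hs Ist IS zI xI).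
have := infinite_identity hI hs Ist CI C2 C3 infI.
rewrite (sum_split_top _ Ist) => /eqP; rewrite addr_eq0 => /eqP e.
have term_eq K : K `<=` I -> gen_series I (C `&` parabolic I `&` parabolic K)%classic /
    fps_subst_exp 2 (gen_series I (parabolic K)) =
    gen_series S (C `&` parabolic K)%classic /
    fps_subst_exp 2 (gen_series S (parabolic K)).
  move=> KI; rewrite (gen_series_sub hN IS (parabolicS KI)) -setIA.
  rewrite (setIidr (parabolicS KI)) (gen_series_sub hN IS) // => w [_].
  exact: parabolicS.
rewrite term_eq ?fsubset_refl // in e.
have WU := gen_series_parabolic_unit hN IS (isT : 0 < 2)%N.
rewrite -[X in fps_rational X](divrK WU).
apply: fps_rationalM; last first.
  by rewrite -[X in fps_rational X]invrK; apply: fps_rationalV; rewrite ?unitrV //;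
    exact: inv_parabolic_rational.
rewrite -[X in fps_rational X](signrMK (star_orbits star I)) e.
apply: fps_rational_sign; apply: fps_rationalN; apply: fps_rational_sum => K.
rewrite fpowersetE => KI /andP[KI' Kst]; rewrite term_eq //; apply: fps_rational_sign.
have KS := fsubset_trans KI IS.
apply: fps_rationalM; last exact: inv_parabolic_rational.
apply: IHn => //.
by rewrite -ltnS (leq_trans _ lI) // ltnS fproper_ltn_card.
Qed.

End Rationality.

(** * Finite groups *)

Lemma cancel_quotient (F : fieldType) (s x y m : F) :
  y != 0 -> s * (x / y) * (y * m) = s * (x * m).
Proof. by move=> y0; rewrite -!mulrA mulKf. Qed.

Lemma solve_signed (F : fieldType) k (x y t u : F) :
  (-1) ^+ k * (x / t) + u = y / t -> (x - (-1) ^+ k * y) / t = - ((-1) ^+ k * u).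
Proof. by move=> h; rewrite mulrBl -mulrA -h mulrDr signrMK opprD addrA subrr add0r. Qed.

Section Finite.
Variables (W : groupType) (S : {fset W}) (N : W -> {fset W}).
Hypothesis hN : inversion_cocycle S N.

Local Notation len w := (#|` N w%g|).

Lemma gen_evalE (R : comNzRingType) (A : set W) (x : R) : finite_set A ->
  gen_eval S A x = \sum_(w <- fset_set A) x ^+ clength S w.
Proof. by move=> finA; rewrite /gen_eval fsbig_finite. Qed.

Lemma gen_eval_rmorph (R R' : comNzRingType) (f : {rmorphism R -> R'}) (A : set W) (x
  : R) :
  finite_set A -> f (gen_eval S A x) = gen_eval S A (f x).
Proof.
by move=> finA; rewrite !gen_evalE // rmorph_sum; apply: eq_bigr => w _; rewrite rmorphXn.
Qed.

Lemma subst_gen_series k (A : set W) : (0 < k)%N -> finite_set A ->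
  fps_subst_exp k (gen_series S A) = fps_of_poly (gen_eval S A ('X ^+ k)).
Proof.
move=> k0 finA; rewrite gen_series_finite // fps_subst_poly //.
by rewrite -['X^k in RHS]comp_polyX (gen_eval_rmorph (comp_poly 'X^k)).
Qed.

Variable star : {multiplicative W -> W}.
Hypothesis hs : involutive star.
Hypothesis hS : star_stable star S.
Variable C : set W.
Hypothesis CS : (C `<=` parabolic S)%classic.
Hypothesis Ctw : forall z, C z -> star z = z^-1%g.
Hypothesis Ccl : forall z x, C z -> parabolic S x -> C (x^-1 * z * star x)%g.
Variable w0 : W.
Hypotheses (w0S : parabolic S w0) (Sw0 : S `<=` N w0).

Local Notation r := (star_orbits star).

Let finS : finite_set (parabolic S) := longest_finite hN w0S Sw0.
Let finC : finite_set C := sub_finite_set CS finS.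
Let finP I : I `<=` S -> finite_set (parabolic I).
Proof. by move=> IS; exact: sub_finite_set (parabolicS IS) finS. Qed.
Let finM I : finite_set (min_reps S N I) := sub_finite_set (@min_reps_sub _ S N I) finS.
Let finCI I : finite_set (C `&` parabolic I)%classic := finite_setIl _ finC.

Let c I : {poly rat} := gen_eval S (C `&` parabolic I)%classic 'X.
Let m I : {poly rat} := gen_eval S (min_reps S N I) ('X ^+ 2).
Let p I : {poly rat} := gen_eval S (parabolic I) ('X ^+ 2).
(** This is q^(2N) C(-q^-1), written as a polynomial with N the length of w0. *)
Let d : {poly rat} := \sum_(z <- fset_set C) (-1) ^+ len z * 'X^(2 * len w0 - len z).

Let poly_identity : \sum_(I <- fpowerset S | star_stable star I) (-1) ^+ r I * (c I *
  m I) = d.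
Proof.
apply: fps_of_poly_inj; rewrite fps_of_poly_sum.
have [red hred] := exists_reduction hN hs hS CS Ctw.
transitivity (\sum_(I <- fpowerset S | star_stable star I) (-1) ^+ r I *
  (gen_series S (C `&` parabolic I)%classic * fps_subst_exp 2 (gen_series S (min_reps
    S N I)))).
  apply: eq_bigr => I _; rewrite fps_of_poly_sign fps_of_polyM.
  by rewrite gen_series_finite // subst_gen_series.
apply: fpsP => n; rewrite (series_sum_finite hN hs hS CS Ctw Ccl hred w0S Sw0) /=.
rewrite /d coef_sum.
transitivity (\sum_(z <- fball S N n | `[< C z >] && (2 * len w0 - len z == n)%N)
   (-1) ^+ len z : rat).
  by rewrite [RHS]big_mkcond; apply: eq_bigr => z _; case: ifP; rewrite ?mul1r ?mul0r.
transitivity (\sum_(z <- fset_set C | (2 * len w0 - len z == n)%N) (-1) ^+ len z : rat).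
  (* From l(z) <= N follows l(z) <= 2N - l(z) = n, so the ball of radius n contains every z that
     contributes. *)
  apply: (sum_reindex (f := id) (g := id)) => z; last first.
    rewrite in_fset_set // inE => Cz /eqP e; rewrite e eqxx andbT; split=> //.
      apply/(fballP hN); split; first exact: CS.
      have := longest_max hN Sw0 w0S (CS Cz); move: e.
      by move: (len w0) (len z) => a b; lia.
    exact/asboolP.
  move=> _ /andP[/asboolP Cz e]; split=> //.
  by rewrite in_fset_set // inE.
rewrite big_mkcond; apply: eq_bigr => z _.
rewrite -(rmorph_sign (@polyC rat)) coefCM coefXn eq_sym.
by case: eqP; rewrite ?mulr1 ?mulr0.
Qed.

Let poly_factor I : I `<=` S -> p I * m I = p S.
Proof.
move=> IS; apply: fps_of_poly_inj; rewrite fps_of_polyM -!subst_gen_series //.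
- exact: gen_series_factor.
- exact: finP.
Qed.

Let p_neq0 I : I `<=` S -> p I != 0.
Proof.
move=> IS; apply/eqP => p0; have := gen_series_parabolic_unit hN IS (isT : 0 < 2)%N.
have -> : fps_subst_exp 2 (gen_series S (parabolic I)) = fps_of_poly (p I).
  by apply: subst_gen_series => //; exact: finP.
by rewrite p0 fps_of_poly0 unitr0.
Qed.

Lemma ratq_neq0 : ratq != 0.
Proof. by rewrite tofrac_eq0 polyX_eq0. Qed.

Let evC I : gen_eval S (C `&` parabolic I)%classic ratq = tofrac (c I).
Proof. by rewrite (gen_eval_rmorph (@tofrac _)). Qed.

Let evP I : I `<=` S -> gen_eval S (parabolic I) (ratq ^+ 2) = tofrac (p I).
Proof. by move=> IS; rewrite (gen_eval_rmorph (@tofrac _) 'X^2 (finP IS)) rmorphXn. Qed.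

Let evd : ratq ^+ (2 * len w0) * gen_eval S C (- ratq^-1) = tofrac d.
Proof.
rewrite gen_evalE // rmorph_sum big_distrr; apply: eq_big_seq => z /=.
rewrite in_fset_set // inE => Cz; rewrite (clength_cocycle hN (CS Cz)).
rewrite rmorphM rmorph_sign rmorphXn -/ratq exprB ?unitfE ?ratq_neq0 //; last first.
  have := longest_max hN Sw0 w0S (CS Cz).
  by move: (len w0) (len z) => a b; lia.
by rewrite [(- ratq^-1) ^+ _]exprNn exprVn mulrCA.
Qed.

(** Dividing [poly_identity] by W(q^2) = p I * m I turns each product into a quotient by [p I]; it
    then remains to isolate the term I = S after multiplying by (-1)^r(S). *)
Lemma finite_identity :
  (gen_eval S (C `&` parabolic S)%classic ratq +
     (-1) ^ ((r S)%:Z - 1) * ratq ^+ (2 * len w0) * gen_eval S C (- ratq^-1)) /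
    gen_eval S (parabolic S) (ratq ^+ 2) =
  \sum_(I <- fpowerset S | (I `<` S) && star_stable star I)
    (-1) ^ ((r (S `\` I))%:Z - 1) *
    (gen_eval S (C `&` parabolic I)%classic ratq / gen_eval S (parabolic I) (ratq ^+ 2)).
Proof.
rewrite (proper_sign_sum hs hS) -mulrA evd evC evP // exprN1_pred mulNr.
have pS0 : tofrac (p S) != 0 by rewrite tofrac_eq0 p_neq0.
have : \sum_(I <- fpowerset S | star_stable star I) (-1) ^+ r I *
    (gen_eval S (C `&` parabolic I)%classic ratq / gen_eval S (parabolic I) (ratq ^+ 2)) =
    tofrac d / tofrac (p S).
  apply: (mulIf pS0); rewrite divfK // -poly_identity [RHS]rmorph_sum [LHS]big_distrl.
  rewrite big_seq_cond [RHS]big_seq_cond; apply: eq_bigr => I.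
  rewrite fpowersetE => /andP[IS _] /=; rewrite evC evP // rmorphM rmorph_sign rmorphM.
  rewrite -(poly_factor IS) [tofrac (p I * _)]rmorphM.
  by apply: cancel_quotient; rewrite tofrac_eq0 p_neq0.
rewrite (sum_split_top _ hS) evC evP //; exact: solve_signed.
Qed.

End Finite.

(** * Assembly for a Coxeter system *)

Local Open Scope classical_set_scope.
Local Open Scope ring_scope.

Theorem theorem1p1 (W : groupType) (S : {fset W}) (star : {multiplicative W -> W})
    (C : set W) :
  coxeter_system S ->
  involutive star -> star_stable star S ->
  C `<=` twisted_involutions star ->
  (forall z x : W, C z -> C (x^-1 * z * star x)%g) ->
  let r := star_orbits star in
  let CI (I : {fset W}) := C `&` parabolic I in
  [/\ fps_rational (gen_series S C),
      infinite_set [set: W] ->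
        \sum_(I <- fpowerset S | star_stable star I)
            (-1) ^+ r I *
            (gen_series S (CI I) /
             fps_subst_exp 2 (gen_series S (parabolic I))) = 0
        /\
        gen_series S C / fps_subst_exp 2 (gen_series S [set: W]) =
        \sum_(I <- fpowerset S | (I `<` S)%fset && star_stable star I)
            (-1) ^ ((r (S `\` I)%fset)%:Z - 1) *
            (gen_series S (CI I) /
             fps_subst_exp 2 (gen_series S (parabolic I)))
    & finite_set [set: W] ->
      forall w0 : W, (forall w, (clength S w <= clength S w0)%N) ->
      let N := clength S w0 in
      (gen_eval S C ratq +
         (-1) ^ ((r S)%:Z - 1) * ratq ^+ (2 * N) * gen_eval S C (- ratq^-1)) /
        gen_eval S [set: W] (ratq ^+ 2) =
      \sum_(I <- fpowerset S | (I `<` S)%fset && star_stable star I)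
          (-1) ^ ((r (S `\` I)%fset)%:Z - 1) *
          (gen_eval S (CI I) ratq /
           gen_eval S (parabolic I) (ratq ^+ 2))].
Proof.
move=> cox hs hS Ctw Ccl r CI; have [N hN] := coxeter_cocycle cox.
have [_ gen _] := cox.
have PS w : parabolic S w by rewrite gen.
have CS : C `<=` parabolic S by rewrite gen.
have Ccl' z x : C z -> parabolic S x -> C (x^-1 * z * star x)%g by move=> Cz _;
  exact: Ccl.
have CE : C `&` parabolic S = C by rewrite gen setIT.
split.
- rewrite -CE; apply: (twisted_class_rational hN hs Ctw Ccl' _ hS).
  exact: fsubset_refl.
- rewrite -gen => infS; have e := infinite_identity hN hs hS CS Ctw Ccl' infS.
  by split=> //; rewrite -{1}CE; exact: (term_identity hs hS e).
rewrite -gen => finS w0 w0max; rewrite /= (clength_cocycle hN (PS w0)) -{1}CE.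
(* Maximal length says exactly that no left multiplication by a generator lengthens w0, so every
   generator is a left descent. *)
have Sw0 : (S `<=` N w0)%fset.
  apply/fsubsetP => s sS; rewrite (len_ltP hN _ sS).
  by have := w0max (s * w0)%g; rewrite !(clength_cocycle hN).
exact: (finite_identity hN hs hS CS Ctw Ccl' (PS w0) Sw0).
Qed.
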